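(* There exists a constant $C>0$ such that the following holds. Let $f\colon\{0,1\}^n\to\{0,1\}$ satisfy $W^{>k}(f)\le\varepsilon\le 2^{-Ck}$, where $k$ is a positive integer. Then there exists a function $g\colon\{0,1\}^n\to\{0,1\}$ of degree at most $k$ with \[\Pr_x[f(x)\neq g(x)]\le \varepsilon+\varepsilon^2\frac{(2\ln(1/\varepsilon))^k}{k!},\] where $x$ is uniform on $\{0,1\}^n$.
   Context: Every $f\colon\{0,1\}^n\to\mathbb{R}$ has a unique Fourier–Walsh expansion $f=\sum_{S\subseteq[n]}\hat f(S)\chi_S$ with $\chi_S(x)=\prod_{i\in S}(-1)^{x_i}$. $f$ has degree at most $k$ if $\hat f(S)=0$ whenever $|S|>k$, and $W^{>k}(f)=\sum_{|S|>k}\hat f(S)^2$. *)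

(* Defs.v *)
From mathcomp Require Import all_boot all_order all_algebra.
From mathcomp Require Import all_classical all_reals all_analysis.

Set Implicit Arguments.
Unset Strict Implicit.
Unset Printing Implicit Defensive.

Import Order.TTheory GRing.Theory Num.Theory.

Local Open Scope ring_scope.

Definition cube (n : nat) : finType := {ffun 'I_n -> bool}.

Definition chi (R : realType) (n : nat) (S : {set 'I_n}) (x : cube n) : R :=
  \prod_(i in S) (-1) ^+ x i.

(* The coefficient of [chi S] in the Fourier-Walsh expansion of [f], given by
   the inversion formula; [fourier_expansion] and [fourier_unique] below show
   that these are exactly the coefficients of the unique expansion. *)
Definition fourier (R : realType) (n : nat) (f : cube n -> R)
    (S : {set 'I_n}) : R :=
  (\sum_(x : cube n) f x * chi R S x) / 2 ^+ n.

Lemma sum_chi_set (R : realType) (n : nat) (x y : cube n) :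
  \sum_(S : {set 'I_n}) chi R S x * chi R S y = (x == y)%:R * 2 ^+ n.
Proof.
have -> : \sum_(S : {set 'I_n}) chi R S x * chi R S y =
          \prod_(i < n) ((-1) ^+ x i * (-1) ^+ y i + 1).
  rewrite bigA_distr; apply: eq_bigr => S _.
  by rewrite /chi -big_split -big_mkcond.
have [<-|neq_xy] := eqVneq x y.
  rewrite mul1r (eq_bigr (fun=> 2)) ?prodr_const ?card_ord // => i _.
  by rewrite -signr_addb addbb.
have [i neq_i] : exists i, x i != y i.
  apply/existsP; rewrite -negb_forall; apply: contra neq_xy => /forallP eq_xy.
  by apply/eqP/ffunP => i; apply/eqP.
rewrite mul0r (bigD1 i) //= -signr_addb.
by case: (x i) (y i) neq_i => [] [] //= _; rewrite addNr mul0r.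
Qed.

Lemma sum_chi_cube (R : realType) (n : nat) (S T : {set 'I_n}) :
  \sum_(x : cube n) chi R S x * chi R T x = (S == T)%:R * 2 ^+ n.
Proof.
pose F (i : 'I_n) (b : bool) : R :=
  (-1) ^+ ((i \in S) && b) * (-1) ^+ ((i \in T) && b).
have -> : \sum_(x : cube n) chi R S x * chi R T x =
          \prod_(i < n) \sum_(b : bool) F i b.
  rewrite bigA_distr_bigA; apply: eq_bigr => x _.
  rewrite /chi [in LHS]big_mkcond [X in _ * X]big_mkcond -big_split /=.
  by apply: eq_bigr => i _; rewrite /F; case: (i \in S); case: (i \in T).
have [eq_ST|neq_ST] := eqVneq S T.
  subst T; rewrite mul1r (eq_bigr (fun=> 2)) ?prodr_const ?card_ord // => i _.
  by rewrite big_bool /F /= -!signr_addb !addbb.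
have [i neq_i] : exists i, (i \in S) != (i \in T).
  apply/existsP; rewrite -negb_forall; apply: contra neq_ST => /forallP eq_ST.
  by apply/eqP/setP => i; apply/eqP.
rewrite mul0r (bigD1 i) //= big_bool /F -!signr_addb.
by case: (i \in S) (i \in T) neq_i => [] [] //= _; rewrite addNr mul0r.
Qed.

Lemma fourier_expansion (R : realType) (n : nat) (f : cube n -> R) (x : cube n) :
  f x = \sum_(S : {set 'I_n}) fourier f S * chi R S x.
Proof.
have -> : \sum_(S : {set 'I_n}) fourier f S * chi R S x =
    (\sum_y \sum_S f y * (chi R S y * chi R S x)) / 2 ^+ n.
  rewrite exchange_big /= big_distrl /=; apply: eq_bigr => S _.
  rewrite /fourier mulrAC big_distrl /=; congr (_ / _).
  by apply: eq_bigr => y _; rewrite mulrA.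
under eq_bigr => y _ do rewrite -big_distrr /= sum_chi_set.
rewrite (bigD1 x) //= eqxx big1 ?addr0 => [|y /negbTE->]; last first.
  by rewrite mul0r mulr0.
by rewrite mul1r mulfK // expf_neq0 // pnatr_eq0.
Qed.

Lemma fourier_unique (R : realType) (n : nat) (f : cube n -> R)
    (c : {set 'I_n} -> R) :
  (forall x, f x = \sum_(S : {set 'I_n}) c S * chi R S x) ->
  forall S, fourier f S = c S.
Proof.
move=> fE S.
have -> : fourier f S =
    (\sum_T \sum_x c T * (chi R T x * chi R S x)) / 2 ^+ n.
  rewrite /fourier exchange_big /=; congr (_ / _); apply: eq_bigr => x _.
  by rewrite fE big_distrl /=; apply: eq_bigr => T _; rewrite mulrA.
under eq_bigr => T _ do rewrite -big_distrr /= sum_chi_cube.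
rewrite (bigD1 S) //= eqxx big1 ?addr0 => [|T /negbTE->]; last first.
  by rewrite mul0r mulr0.
by rewrite mul1r mulfK // expf_neq0 // pnatr_eq0.
Qed.

Definition degree_le (R : realType) (n k : nat) (f : cube n -> R) : Prop :=
  forall S : {set 'I_n}, (k < #|S|)%N -> fourier f S = 0.

Definition weight_gt (R : realType) (n k : nat) (f : cube n -> R) : R :=
  \sum_(S : {set 'I_n} | (k < #|S|)%N) fourier f S ^+ 2.

Definition realify (R : realType) (n : nat) (f : cube n -> bool) : cube n -> R :=
  fun x => (f x)%:R.

Definition Pr_unif (R : realType) (n : nat) (A : {set cube n}) : R :=
  #|A|%:R / #|cube n|%:R.

(* Main.v *)
(** A level-[k] inequality with the constant of Gaussian half-spaces carries the
    argument.  For [p] with values in [-1, 1] and mean absolute value [delta] with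
    [L = ln (1 / delta) >= C k], the Fourier weight of [p] on levels at most [k] is
    at most [(1 - k / L) delta ^ 2 (2 L) ^ k / k!].  To gain the factor [1 - k / L]
    over the usual hypercontractive estimates, put a coordinate into a block [J]
    with probability [1 / k] and keep the monomials of degree [k] meeting [J] once.
    Given the coordinates outside [J], the part inside [J] is linear, and a level-1
    inequality with [2 l - (ln l) / 8] in place of [2 l] follows by induction on the
    dimension from a two-point inequality.  The coefficients are polynomials of
    degree [k - 1], whose even moments are bounded by counting pairings of half-edges
    without loops; Hoelder's inequality then combines both factors.

    The degree-[k] approximation is found by induction on the set of relevant
    coordinates.  If there are few of them, granularity of the coefficients makes
    the weight above level [k] vanish.  Otherwise each relevant [i] has a face
    [x i = b i] on which the weight does not increase, hence an approximation
    [g i]; these are consistent because the level-[k] inequality forbids two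
    distinct boolean functions of degree [k] to be close, so they glue to a
    function [G] of degree [k].  The polynomial [G ^ 2 - G] has degree at most [2 k]
    and lives on one point of the cube of relevant coordinates, so [G] is boolean.
    Applied to [f - g], the level-[k] inequality finally gives the sharp error. *)

Require Import Defs.
From mathcomp Require Import all_boot all_order all_algebra.
From mathcomp Require Import all_classical all_reals all_analysis.
From mathcomp Require Import fintype finset zify ring lra.

Set Implicit Arguments.
Unset Strict Implicit.
Unset Printing Implicit Defensive.

Import Order.TTheory GRing.Theory Num.Theory.
Import numFieldNormedType.Exports.

Local Open Scope ring_scope.

(** * Inequalities for the logarithm *)

Section RealInequalities.
Variable R : realType.
Implicit Types x y z t l : R.

Lemma ln_le_subr1 t : 0 < t -> ln t <= t - 1.
Proof.
move=> t0; have := @le_ln1Dx R (t - 1).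
by rewrite (_ : 1 + (t - 1) = t); [apply; lra | ring].
Qed.

(** The right side is the start of a Taylor series; the derivative of the difference is
    [2 y^4 / (1 - y^2)]. *)
Lemma ln_ratio_ge x : 0 <= x -> x < 1 ->
  2 * x + 2 / 3 * x ^+ 3 <= ln (1 + x) - ln (1 - x).
Proof.
move=> x0 x1.
pose g (y : R) := ln (1 + y) - ln (1 - y) - 2 * y - 2 / 3 * y ^+ 3.
have dg (y : R) : -1 < y -> y < 1 ->
    is_derive y 1 g ((1 + y)^-1 + (1 - y)^-1 - 2 - 2 * y ^+ 2).
  move=> y0 y1; rewrite /g.
  have d1 : is_derive (1 + y) 1 (@ln R) (1 + y)^-1 by apply: is_derive1_ln; lra.
  have d2 : is_derive (1 - y) 1 (@ln R) (1 - y)^-1 by apply: is_derive1_ln; lra.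
  apply: is_derive_eq.
  rewrite /GRing.scale /=.
  field.
  by apply/andP; split; apply/eqP; lra.
suff : g 0 <= g x by rewrite /g subr0 addr0 ln1; lra.
apply: (@ger0_derive1_ndecr R g 0 x) => //.
- move=> y; rewrite in_itv /= => /andP[y0 yx]; have [||d _] := dg y; [lra | lra | exact: d].
- move=> y; rewrite in_itv /= => /andP[y0 yx].
  have [||? de] := dg y; [lra | lra |].
  rewrite derive1E de.
  have -> : (1 + y)^-1 + (1 - y)^-1 - 2 - 2 * y ^+ 2 =
      2 * y ^+ 4 / ((1 + y) * (1 - y)).
    by field; apply/andP; split; apply/eqP; lra.
  apply: divr_ge0; first by apply: mulr_ge0 => //; apply: exprn_ge0; lra.
  by apply: mulr_ge0; lra.
- apply: derivable_within_continuous => y; rewrite in_itv /= => /andP[y0 yx].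
  by have [||d _] := dg y; [lra | lra | exact: d].
Qed.

(** The difference vanishes at [0] and has nonnegative derivative by [ln_ratio_ge]. The quartic term
    pays for the errors in [psi_two_point] when [x > 1/2]. *)
Lemma entropy_ge x : 0 <= x -> x < 1 ->
  x ^+ 2 + x ^+ 4 / 6 <= (1 + x) * ln (1 + x) + (1 - x) * ln (1 - x).
Proof.
move=> x0 x1.
pose g (y : R) := (1 + y) * ln (1 + y) + (1 - y) * ln (1 - y) - y ^+ 2 - y ^+ 4 / 6.
have dg (y : R) : -1 < y -> y < 1 ->
    is_derive y 1 g (ln (1 + y) - ln (1 - y) - 2 * y - 2 / 3 * y ^+ 3).
  move=> y0 y1; rewrite /g.
  have d1 : is_derive (1 + y) 1 (@ln R) (1 + y)^-1 by apply: is_derive1_ln; lra.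
  have d2 : is_derive (1 - y) 1 (@ln R) (1 - y)^-1 by apply: is_derive1_ln; lra.
  apply: is_derive_eq.
  rewrite /GRing.scale /=.
  field.
  by apply/andP; split; apply/eqP; lra.
suff : g 0 <= g x by rewrite /g subr0 addr0 ln1; lra.
apply: (@ger0_derive1_ndecr R g 0 x) => //.
- move=> y; rewrite in_itv /= => /andP[y0 yx]; have [||d _] := dg y; [lra | lra | exact: d].
- move=> y; rewrite in_itv /= => /andP[y0 yx].
  have [||? de] := dg y; [lra | lra |].
  rewrite derive1E de.
  by have := @ln_ratio_ge y; lra.
- apply: derivable_within_continuous => y; rewrite in_itv /= => /andP[y0 yx].
  by have [||d _] := dg y; [lra | lra | exact: d].
Qed.

Lemma ln2_gt : 3 / 5 < ln (2 : R).
Proof.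
have := @ln_ratio_ge (1/3).
rewrite -ln_div ?posrE; [|lra|lra].
rewrite (_ : (1 + 1/3) / (1 - 1/3) = 2 :> R); last by field.
by lra.
Qed.

Lemma expr_fact_le_expR k x : 0 <= x -> x ^+ k / k`!%:R <= expR x.
Proof.
case: k => [|k] x0; first by rewrite expr0 fact0 divr1; have := expR_ge1Dx x; lra.
by apply: le_trans (expR_ge1Dxn k x0); lra.
Qed.

Lemma subr1_ge_expR z : 0 <= z -> z <= 1 / 2 -> expR (- (2 * z)) <= 1 - z.
Proof.
move=> z0 z1; rewrite expRN.
rewrite -[leLHS]mul1r ler_pdivrMr ?expR_gt0 //.
have := expR_ge1Dx (2 * z) => h.
apply: (@le_trans _ _ ((1 - z) * (1 + 2 * z))); first by nra.
by apply: ler_wpM2l => //; lra.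
Qed.

End RealInequalities.

(** * The Bellman function of the level-1 inequality *)

Section BellmanFunction.
Variable R : realType.
Implicit Types a b x y l : R.

(** The classical level-1 bound is [2 l] with [l = ln (1 / a)]; the logarithm is the saving. The
    squared Gaussian isoperimetric profile behaves like [a^2 (2 l - ln l)], so the coefficient
    [1 / 8] leaves room for crude estimates. *)
Definition psi l : R := 2 * l - ln l / 8.

(** Intended as a bound for the Euclidean norm of the degree-1 coefficients of a [0, 1]-valued
    function of mean [a]. The shift [l0] keeps the argument of [psi] large even for [a] near [1]; at
    [a = 0] the outer factor hides the default value of [ln 0]. *)
Definition bell l0 a : R := a * Num.sqrt (psi (l0 - ln a)).

Lemma psi_ge l : 0 < l -> 15 / 8 * l <= psi l.
Proof. by move=> l0; rewrite /psi; have := ln_le_subr1 l0; lra. Qed.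

Lemma psi_le l : 1 <= l -> psi l <= 2 * l.
Proof. by move=> l1; rewrite /psi; have := ln_ge0 l1; lra. Qed.

Lemma psi_incr l y : 1 <= l -> 0 <= y -> psi l + 15 / 8 * y <= psi (l + y).
Proof.
move=> l1 y0; rewrite /psi.
have h : ln (l + y) - ln l <= y.
  rewrite -ln_div ?posrE; [|lra|lra].
  have p : 0 < (l + y) / l by apply: divr_gt0; lra.
  apply: le_trans (ln_le_subr1 p) _.
  rewrite mulrDl divff; last by apply/eqP; lra.
  by rewrite addrAC subrr add0r ler_pdivrMr; nra.
lra.
Qed.

(** Serves for both signs of [y], namely [ln (1 + x)] and [ln (1 - x)]. With [z = y / l <= 1/2] it
    rests on [- ln (1 - z) <= z + 2 z^2]. *)
Lemma psi_sub_le l y : 0 < l -> 2 * y <= l ->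
  psi (l - y) <= psi l - 2 * y + y / (8 * l) + y ^+ 2 / (4 * l ^+ 2).
Proof.
move=> l0 yl; rewrite /psi.
set z := y / l.
have z2 : z <= 1 / 2 by rewrite /z ler_pdivrMr //; lra.
have -> : l - y = l * (1 - z) by rewrite /z; field; apply/eqP; lra.
rewrite lnM ?posrE //; last by lra.
have h : - ln (1 - z) <= z + 2 * z ^+ 2.
  rewrite -lnV ?posrE; last by lra.
  have p : 0 < (1 - z)^-1 by rewrite invr_gt0; lra.
  apply: le_trans (ln_le_subr1 p) _.
  have -> : (1 - z)^-1 - 1 = z + z ^+ 2 * (1 - z)^-1 by field; apply/eqP; lra.
  have : (1 - z)^-1 <= 2 by rewrite -[leRHS]invrK lef_pV2 ?posrE; lra.
  have := sqr_ge0 z; nra.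
have -> : y / (8 * l) = z / 8 by rewrite /z; field; apply/eqP; lra.
have -> : y ^+ 2 / (4 * l ^+ 2) = z ^+ 2 / 4 by rewrite /z; field; apply/eqP; lra.
have -> : 2 * (l * (1 - z)) = 2 * l - 2 * y by rewrite /z; field; apply/eqP; lra.
lra.
Qed.

(** With [s = sqrt t] this becomes [s (- ln s) <= 1], from [- ln s <= 1 / s - 1]. It tames
    [ln (1 - x)] as [x] approaches [1]. *)
Lemma ln_sqr_le t : 0 < t -> t <= 1 -> t * (ln t) ^+ 2 <= 4 :> R.
Proof.
move=> t0 t1; set s := Num.sqrt t.
have s0 : 0 < s by rewrite sqrtr_gt0.
have ts : t = s ^+ 2 by rewrite sqr_sqrtr // ltW.
have lns : ln t = 2 * ln s by rewrite ts lnXn // mulr_natl.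
have h1 : ln s <= 0 by apply: ln_le0; rewrite -sqrtr1 ler_sqrt.
have h2 : - ln s <= s^-1 - 1.
  by rewrite -lnV ?posrE //; apply: ln_le_subr1; rewrite invr_gt0.
have h3 : s * s^-1 = 1 by rewrite divff // gt_eqF.
rewrite lns ts.
have h4 : s * (- ln s) <= 1 by nra.
have h5 : 0 <= s * (- ln s) by nra.
by have -> : s ^+ 2 * (2 * ln s) ^+ 2 = 4 * (s * (- ln s)) ^+ 2; [ring | nra].
Qed.

(** The weighted mean of [psi] drops by [e1 >= x^2 + x^4 / 6], which absorbs [x^2] up to errors of
    order [x^2 / l]. For [x <= 1/2] the variance of the square roots beats these errors; for
    [x > 1/2] the quartic term does. *)
Lemma psi_two_point l x : 100 <= l -> 0 <= x -> x < 1 ->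
  (((1 + x) * Num.sqrt (psi (l - ln (1 + x))) +
    (1 - x) * Num.sqrt (psi (l - ln (1 - x)))) / 2) ^+ 2 + x ^+ 2 <= psi l.
Proof.
move=> l100 x0 x1.
set yp := ln (1 + x); set ym := ln (1 - x).
set pp := psi (l - yp); set pm := psi (l - ym).
set sp := Num.sqrt pp; set sm := Num.sqrt pm.
have yp0 : 0 <= yp by apply: ln_ge0; lra.
have ypx : yp <= x by have := @ln_le_subr1 _ (1 + x); rewrite -/yp; lra.
have ymx : ym <= - x by have := @ln_le_subr1 _ (1 - x); rewrite -/ym; lra.
have pp0 : 0 <= pp by have := @psi_ge (l - yp); rewrite -/pp; lra.
have pm0 : 0 <= pm by have := @psi_ge (l - ym); rewrite -/pm; lra.
have spE : sp ^+ 2 = pp by rewrite sqr_sqrtr.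
have smE : sm ^+ 2 = pm by rewrite sqr_sqrtr.
have sp0 : 0 <= sp by apply: sqrtr_ge0.
have sm0 : 0 <= sm by apply: sqrtr_ge0.
(* The square of a mean is the mean of the squares minus the weighted variance. *)
have -> : (((1 + x) * sp + (1 - x) * sm) / 2) ^+ 2 =
    ((1 + x) * pp + (1 - x) * pm) / 2 - (1 - x ^+ 2) / 4 * (sm - sp) ^+ 2.
  by rewrite -spE -smE; field.
have E1 := entropy_ge x0 x1; rewrite -/yp -/ym in E1.
have hp : pp <= psi l - 2 * yp + yp / (8 * l) + yp ^+ 2 / (4 * l ^+ 2).
  by apply: psi_sub_le; lra.
have hm : pm <= psi l - 2 * ym + ym / (8 * l) + ym ^+ 2 / (4 * l ^+ 2).
  by apply: psi_sub_le; lra.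
set e1 := (1 + x) * yp + (1 - x) * ym in E1.
set e2 := (1 + x) * yp ^+ 2 + (1 - x) * ym ^+ 2.
have e1u : e1 <= 2 * x ^+ 2 by rewrite /e1; nra.
set li := l^-1.
have li0 : 0 < li by rewrite invr_gt0; lra.
have liu : li <= 1 / 100.
  by rewrite -[leRHS]invrK lef_pV2 ?posrE ?invr_gt0; lra.
have main : ((1 + x) * pp + (1 - x) * pm) / 2 <=
    psi l - e1 + e1 * li / 16 + e2 * li ^+ 2 / 8.
  have hp' : (1 + x) * pp <= (1 + x) *
      (psi l - 2 * yp + yp / (8 * l) + yp ^+ 2 / (4 * l ^+ 2)).
    by apply: ler_wpM2l => //; lra.
  have hm' : (1 - x) * pm <= (1 - x) *
      (psi l - 2 * ym + ym / (8 * l) + ym ^+ 2 / (4 * l ^+ 2)).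
    by apply: ler_wpM2l => //; lra.
  have -> : psi l - e1 + e1 * li / 16 + e2 * li ^+ 2 / 8 =
   ((1 + x) * (psi l - 2 * yp + yp / (8 * l) + yp ^+ 2 / (4 * l ^+ 2)) +
    (1 - x) * (psi l - 2 * ym + ym / (8 * l) + ym ^+ 2 / (4 * l ^+ 2))) / 2.
    by rewrite /e1 /e2 /li; field; apply/eqP; lra.
  lra.
have e1li : e1 * li <= 2 * x ^+ 2 * li by apply: ler_wpM2r => //; lra.
have [xs|xl] := lerP x (1 / 2).
  have ymx2 : - (2 * x) <= ym.
    rewrite /ym -[1 - x]invrK lnV ?posrE ?invr_gt0; last by lra.
    have p : 0 < (1 - x)^-1 by rewrite invr_gt0; lra.
    have := ln_le_subr1 p.
    have : (1 - x)^-1 <= 1 + 2 * x.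
      by rewrite -[leLHS]mul1r ler_pdivrMr; nra.
    lra.
  have e2u : e2 <= 5 * x ^+ 2.
    have : yp ^+ 2 <= x ^+ 2 by nra.
    have : ym ^+ 2 <= 4 * x ^+ 2 by nra.
    rewrite /e2; nra.
  have dps : 15 / 8 * (2 * x) <= pm - pp.
    have := @psi_incr (l - yp) (yp - ym).
    rewrite (_ : l - yp + (yp - ym) = l - ym) -/pp -/pm; last by ring.
    have := ln_ratio_ge x0 x1; rewrite -/yp -/ym.
    have : 0 <= x ^+ 3 by apply: exprn_ge0.
    lra.
  have pmu : pm <= 21 / 10 * l.
    by have := @psi_le (l - ym); rewrite -/pm; lra.
  (* The values of [psi] differ by at least [3 x], and the sum of their roots has square at most
     [9 l]. *)
  have dsq : 1 * x ^+ 2 * li <= (sm - sp) ^+ 2.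
    have h1 : (3 * x) ^+ 2 <= (pm - pp) ^+ 2.
      by apply: lerXn2r; rewrite ?nnegrE; lra.
    have h2 : (sm + sp) ^+ 2 <= 9 * l.
      have : sp <= sm by rewrite ler_sqrt //; lra.
      nra.
    have h3 : (pm - pp) ^+ 2 = (sm - sp) ^+ 2 * (sm + sp) ^+ 2.
      by rewrite -spE -smE; ring.
    rewrite mul1r ler_pdivrMr; last by lra.
    have h4 : (sm - sp) ^+ 2 * (sm + sp) ^+ 2 <= (sm - sp) ^+ 2 * (9 * l).
      by apply: ler_wpM2l => //; apply: sqr_ge0.
    lra.
  have gain : 3 / 16 * x ^+ 2 * li <= (1 - x ^+ 2) / 4 * (sm - sp) ^+ 2.
    have : 3 / 16 <= (1 - x ^+ 2) / 4 by nra.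
    have := sqr_ge0 (sm - sp).
    move=> sq0 c0; apply: le_trans (ler_wpM2r sq0 c0).
    by rewrite -mulrA; apply: ler_wpM2l => //; lra.
  have x2li : 0 <= x ^+ 2 * li by apply: mulr_ge0; [exact: sqr_ge0 | lra].
  have e2li : e2 * li ^+ 2 <= 5 / 100 * (x ^+ 2 * li).
    have h1 : e2 * li ^+ 2 <= 5 * x ^+ 2 * li ^+ 2.
      by apply: ler_wpM2r => //; apply: sqr_ge0.
    have h2 : (x ^+ 2 * li) * li <= (x ^+ 2 * li) * (1 / 100).
      by apply: ler_wpM2l.
    have h3 : 5 * x ^+ 2 * li ^+ 2 = 5 * (x ^+ 2 * li * li) by ring.
    lra.
  have x4 : 0 <= x ^+ 4 by apply: exprn_ge0.
  lra.
have e2u : e2 <= 24 * x ^+ 2.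
  have := @ln_sqr_le (1 - x); rewrite -/ym => h.
  have : yp ^+ 2 <= x ^+ 2 by nra.
  rewrite /e2; nra.
have x2 : 0 <= x ^+ 2 by apply: sqr_ge0.
have e2li : e2 * li ^+ 2 <= 24 / 10000 * x ^+ 2.
  have h0 : li ^+ 2 <= 1 / 10000 by nra.
  have h1 : e2 * li ^+ 2 <= 24 * x ^+ 2 * li ^+ 2.
    by apply: ler_wpM2r => //; apply: sqr_ge0.
  have h2 : 24 * x ^+ 2 * li ^+ 2 <= 24 * x ^+ 2 * (1 / 10000).
    by apply: ler_wpM2l => //; lra.
  by rewrite [leRHS](_ : _ = 24 * x ^+ 2 * (1 / 10000));
    [exact: le_trans h1 h2 | field].
have x4 : x ^+ 2 / 4 <= x ^+ 4.
  have -> : x ^+ 4 = x ^+ 2 * x ^+ 2 by ring.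
  have h : x ^+ 2 * (1 / 4) <= x ^+ 2 * x ^+ 2 by apply: ler_wpM2l => //; nra.
  lra.
have : 0 <= (1 - x ^+ 2) / 4 * (sm - sp) ^+ 2.
  by apply: mulr_ge0; [nra | apply: sqr_ge0].
have : 2 * x ^+ 2 * li <= 2 * x ^+ 2 * (1 / 100).
  by apply: ler_wpM2l => //; lra.
move: main e1li e2li E1 x4 x2; clear; lra.
Qed.

End BellmanFunction.

Section BellmanTwoPoint.
Variable R : realType.
Implicit Types a b x y l : R.
Lemma bell_ge0 l0 a : 0 <= a -> 0 <= bell l0 a.
Proof. by move=> a0; apply: mulr_ge0 => //; apply: sqrtr_ge0. Qed.

(** This is the inductive step of the level-1 inequality. Dividing by the mean [m] reduces it to
    [psi_two_point] with [x = (a - b) / (a + b)] and [l = l0 - ln m]. *)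
Lemma bell_two_point l0 a b : 100 <= l0 -> 0 <= a <= 1 -> 0 <= b <= 1 ->
  ((bell l0 a + bell l0 b) / 2) ^+ 2 + ((a - b) / 2) ^+ 2 <=
  bell l0 ((a + b) / 2) ^+ 2.
Proof.
move=> l100.
wlog ba : a b / b <= a.
  move=> H ha hb; have [ba|/ltW ab] := lerP b a; first exact: H.
  have := H b a ab hb ha.
  by rewrite (addrC b a) (addrC (bell l0 b)) -[b - a]opprB mulNr sqrrN.
move=> /andP[a0 a1] /andP[b0 b1].
have [a00|an0] := eqVneq a 0.
  have b00 : b = 0 by lra.
  by rewrite a00 b00 subrr /bell !mul0r addr0 mul0r expr0n /= addr0 sqr_ge0.
have {an0}apos : 0 < a by rewrite lt0r an0.
set m := (a + b) / 2.
have m0 : 0 < m by rewrite /m; lra.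
have lnm : ln m <= 0 by apply: ln_le0; rewrite /m; lra.
set l := l0 - ln m.
have hl : 100 <= l by rewrite /l; lra.
have pl0 : 0 <= psi l by have := @psi_ge _ l; lra.
rewrite [leRHS](_ : _ = m ^+ 2 * psi l); last by rewrite /bell -/m -/l exprMn sqr_sqrtr.
(* The endpoint [x = 1] lies outside [psi_two_point]; there [psi] grows by at least
   [15/8 ln 2 > 1]. *)
have [b00|bn0] := eqVneq b 0.
  have am : a = 2 * m by rewrite /m b00; field.
  rewrite b00 /bell mul0r addr0 subr0.
  have -> : l0 - ln a = l - ln 2 by rewrite am lnM ?posrE // /l; ring.
  have ln2u : ln 2 <= 1 :> R by have := @ln_le_subr1 R 2; lra.
  have := @psi_incr _ (l - ln 2) (ln 2); rewrite subrK.
  have := ln2_gt R.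
  set p := psi (l - ln 2) => h1 h2.
  have p0 : 0 <= p by have := @psi_ge _ (l - ln 2); rewrite -/p; lra.
  have sE : Num.sqrt p ^+ 2 = p by rewrite sqr_sqrtr.
  rewrite am.
  have -> : (2 * m * Num.sqrt p / 2) ^+ 2 + (2 * m / 2) ^+ 2 = m ^+ 2 * (p + 1).
    by rewrite -{2}sE; field.
  by apply: ler_wpM2l; [exact: sqr_ge0 | lra].
have {bn0}bpos : 0 < b by rewrite lt0r bn0.
set x := (a - b) / (a + b).
have ab0 : 0 < a + b by lra.
have x0 : 0 <= x by rewrite /x; apply: divr_ge0; lra.
have x1 : x < 1 by rewrite /x ltr_pdivrMr //; lra.
have aE : a = m * (1 + x) by rewrite /m /x; field; apply/eqP; lra.
have bE : b = m * (1 - x) by rewrite /m /x; field; apply/eqP; lra.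
have H := psi_two_point hl x0 x1.
rewrite /bell.
have -> : l0 - ln a = l - ln (1 + x) by rewrite aE lnM ?posrE //; [rewrite /l; ring | lra].
have -> : l0 - ln b = l - ln (1 - x) by rewrite bE lnM ?posrE //; [rewrite /l; ring | lra].
set sp := Num.sqrt _ in H *; set sm := Num.sqrt _ in H *.
rewrite [in leLHS]aE [in leLHS]bE.
have -> : ((m * (1 + x) * sp + m * (1 - x) * sm) / 2) ^+ 2 +
    ((m * (1 + x) - m * (1 - x)) / 2) ^+ 2 =
  m ^+ 2 * ((((1 + x) * sp + (1 - x) * sm) / 2) ^+ 2 + x ^+ 2) by field.
by apply: ler_wpM2l; [exact: sqr_ge0 | exact: H].
Qed.

(** Concavity, by dropping the squared difference; it recombines the positive and negative parts of
    a signed function. *)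
Lemma bell_midpoint l0 a b : 100 <= l0 -> 0 <= a <= 1 -> 0 <= b <= 1 ->
  bell l0 a + bell l0 b <= 2 * bell l0 ((a + b) / 2).
Proof.
move=> hl ha hb; have H := bell_two_point hl ha hb.
have [a0 _] := andP ha; have [b0 _] := andP hb.
suff : (bell l0 a + bell l0 b) / 2 <= bell l0 ((a + b) / 2) by lra.
rewrite -(@ler_pXn2r _ 2) ?nnegrE //.
- by apply: le_trans H; have := sqr_ge0 ((a - b) / 2); lra.
- by have := bell_ge0 l0 a0; have := bell_ge0 l0 b0; lra.
- by apply: bell_ge0; lra.
Qed.

(* Only a bounded gain over [2 * l] is used, but an arbitrarily large one. *)
Lemma expRN_psi_le (c : R) : exists r0 : nat, forall (r : nat) l,
  (r0 <= r)%N -> 1 <= l ->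
  expR (- l) * psi l ^+ r <= (2 * r%:R / expR 1) ^+ r * expR (- c).
Proof.
(* Beyond [l1] the logarithm in [psi] is at least [16 |c|], so that [psi l <= 2 (l - c)]. *)
pose l1 := expR (16 * `|c|).
have l11 : 1 <= l1.
  rewrite /l1 (le_trans _ (expR_ge1Dx _)) //; have := normr_ge0 c; lra.
have c0 := ler_norm c.
exists (Num.truncn (expR 1 ^+ 2 * l1 + `|c|)).+1 => r l hr l_1.
have hr' : expR 1 ^+ 2 * l1 + `|c| <= r%:R.
  apply: le_trans (ltW (truncnS_gt _)) _.
  by rewrite ler_nat.
have e0 : 0 < expR 1 :> R by apply: expR_gt0.
have lp : 0 < l1 by lra.
have r0 : 0 < r%:R :> R.
  by apply: lt_le_trans hr'; rewrite ltr_wpDr // mulr_gt0 // exprn_gt0.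
(* The maximum of [z^r e^(-z)] is at [z = r], seen from [1 + u <= e^u] at [u = z / r - 1]. *)
have el : forall z : R, 0 <= z -> (2 * z) ^+ r * expR (- z) <= (2 * r%:R / expR 1) ^+ r.
  move=> z z0.
  rewrite expRN ler_pdivrMr ?expR_gt0 //.
  have -> : expR z = expR (z / r%:R) ^+ r.
    by rewrite -expRM_natr divfK // gt_eqF.
  rewrite -exprMn; apply: lerXn2r; rewrite ?nnegrE.
  - by lra.
  - by apply: mulr_ge0; [apply: divr_ge0; lra | exact: expR_ge0].
  have := expR_ge1Dx (z / r%:R - 1); rewrite expRB => h.
  have -> : 2 * r%:R / expR 1 * expR (z / r%:R) =
    2 * r%:R * (expR (z / r%:R) / expR 1) by ring.
  have -> : 2 * z = 2 * r%:R * (1 + (z / r%:R - 1)).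
    by field; apply/eqP; lra.
  by apply: ler_wpM2l => //; lra.
have [ll1|ll1] := lerP l1 l.
  have hln : 16 * `|c| <= ln l by rewrite -[leLHS]expRK ler_ln ?posrE //; lra.
  have hpsi : psi l <= 2 * (l - c) by rewrite /psi; lra.
  have psi0 : 0 <= psi l by have := @psi_ge _ l; lra.
  have -> : expR (- l) = expR (- (l - c)) * expR (- c) by rewrite -expRD; congr expR; ring.
  rewrite mulrAC; apply: ler_wpM2r; first exact: expR_ge0.
  apply: le_trans (el (l - c) _); last by lra.
  rewrite mulrC; apply: ler_wpM2r; first exact: expR_ge0.
  by apply: lerXn2r; rewrite ?nnegrE //; lra.
have psi0 : 0 <= psi l by have := @psi_ge _ l; lra.
have hpsi := psi_le l_1.
(* Below [l1] a bound independent of [l] suffices, because [r >= e^2 l1 + |c|]. *)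
apply: (@le_trans _ _ ((2 * l1) ^+ r)).
  rewrite -[leRHS]mul1r; apply: ler_pM; rewrite ?expR_ge0 ?exprn_ge0 //.
    by rewrite -expR0 ler_expR; lra.
  by apply: lerXn2r; rewrite ?nnegrE //; lra.
have hc : expR c <= expR 1 ^+ r.
  rewrite -expRM_natr mul1r ler_expR.
  have : 0 <= expR 1 ^+ 2 * l1 by apply: mulr_ge0; [exact: sqr_ge0 | lra].
  lra.
rewrite expRN ler_pdivlMr ?expR_gt0 //.
apply: (@le_trans _ _ ((2 * l1) ^+ r * expR 1 ^+ r)).
  by apply: ler_wpM2l => //; apply: exprn_ge0; lra.
rewrite -exprMn; apply: lerXn2r; rewrite ?nnegrE.
- by apply: mulr_ge0; lra.
- by apply: divr_ge0; lra.
rewrite ler_pdivlMr //.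
have := normr_ge0 c; nra.
Qed.

End BellmanTwoPoint.

(** * Means over the cube *)

Section CubeMean.
Variables (R : realType) (n : nat).
Implicit Types (f g h : cube n -> R) (S T D J : {set 'I_n}) (x y : cube n).

Definition avg f : R := (\sum_x f x) / 2 ^+ n.

Let pow2_gt0 : 0 < 2 ^+ n :> R. Proof. exact: exprn_gt0. Qed.

Lemma eq_avg f g : f =1 g -> avg f = avg g.
Proof. by move=> fg; rewrite /avg (eq_bigr g) // => x _; rewrite fg. Qed.

Lemma avgD f g : avg (fun x => f x + g x) = avg f + avg g.
Proof. by rewrite /avg big_split mulrDl. Qed.

Lemma avgZ (a : R) f : avg (fun x => a * f x) = a * avg f.
Proof. by rewrite /avg -big_distrr mulrA. Qed.

Lemma avgN f : avg (fun x => - f x) = - avg f.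
Proof. by rewrite /avg sumrN mulNr. Qed.

Lemma avgB f g : avg (fun x => f x - g x) = avg f - avg g.
Proof. by rewrite avgD avgN. Qed.

Lemma avg_sum (I : Type) (r : seq I) (P : pred I) (F : I -> cube n -> R) :
  avg (fun x => \sum_(i <- r | P i) F i x) = \sum_(i <- r | P i) avg (F i).
Proof. by rewrite /avg exchange_big big_distrl. Qed.

Lemma avg_cst (a : R) : avg (fun=> a) = a.
Proof.
by rewrite /avg sumr_const card_ffun card_bool card_ord -[a *+ _]mulr_natr natrX mulfK ?gt_eqF.
Qed.

Lemma le_avg f g : (forall x, f x <= g x) -> avg f <= avg g.
Proof.
move=> fg; rewrite /avg ler_pM2r ?invr_gt0 //.
by apply: ler_sum => x _.
Qed.

Lemma avg_ge0 f : (forall x, 0 <= f x) -> 0 <= avg f.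
Proof. by move=> f0; rewrite -(avg_cst 0); apply: le_avg. Qed.

Lemma avg_eq0 f : (forall x, 0 <= f x) -> avg f = 0 -> forall x, f x = 0.
Proof.
move=> f0 /eqP; rewrite /avg mulf_eq0 invr_eq0 (gt_eqF pow2_gt0) orbF.
by rewrite psumr_eq0 // => /allP fa x; apply/eqP/fa; rewrite mem_index_enum.
Qed.

Lemma ler_norm_avg f : `|avg f| <= avg (fun x => `|f x|).
Proof.
rewrite /avg normrM normfV (gtr0_norm pow2_gt0) ler_pM2r ?invr_gt0 //.
exact: ler_norm_sum.
Qed.

Lemma fourierE f S : fourier f S = avg (fun x => f x * chi R S x).
Proof. by []. Qed.

Definition sg (i : 'I_n) x : R := (-1) ^+ x i.

Lemma sg_sqr i x : sg i x * sg i x = 1.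
Proof. by rewrite /sg -signr_addb addbb. Qed.

Lemma chi0 x : chi R set0 x = 1.
Proof. by rewrite /chi big_set0. Qed.

Lemma chi_setU1 i S x : i \notin S -> chi R (i |: S) x = sg i x * chi R S x.
Proof. by move=> iS; rewrite /chi big_setU1. Qed.

Lemma chi_setD1 i S x : i \in S -> chi R S x = sg i x * chi R (S :\ i) x.
Proof. by move=> iS; rewrite -{1}(setD1K iS) chi_setU1 // !inE eqxx. Qed.

Lemma chi_sqr S x : chi R S x * chi R S x = 1.
Proof.
rewrite /chi -big_split big1 // => i _; exact: sg_sqr.
Qed.

Definition symdiff S T : {set 'I_n} := (S :\: T) :|: (T :\: S).

Lemma chiM S T x : chi R S x * chi R T x = chi R (symdiff S T) x.
Proof.
rewrite /chi [in LHS]big_mkcond [X in _ * X]big_mkcond [in RHS]big_mkcond.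
rewrite -big_split; apply: eq_bigr => i _ /=.
rewrite !inE; case: (i \in S); case: (i \in T) => //=; rewrite ?mulr1 ?mul1r //.
exact: sg_sqr.
Qed.

Lemma card_symdiff S T : (#|symdiff S T| <= #|S| + #|T|)%N.
Proof.
apply: leq_trans (leq_card_setU _ _) _.
by apply: leq_add; apply: subset_leq_card; rewrite subsetDl.
Qed.

Lemma avg_chi S T : avg (fun x => chi R S x * chi R T x) = (S == T)%:R.
Proof. by rewrite /avg sum_chi_cube mulfK // gt_eqF. Qed.

Lemma avg_set0 f : avg f = fourier f set0.
Proof. by rewrite fourierE; apply: eq_avg => x; rewrite chi0 mulr1. Qed.

Lemma parseval f : avg (fun x => f x ^+ 2) = \sum_S fourier f S ^+ 2.
Proof.
transitivity (avg (fun x => \sum_S fourier f S * (f x * chi R S x))).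
  apply: eq_avg => x; rewrite expr2 {2}(fourier_expansion f x) big_distrr /=.
  by apply: eq_bigr => S _; ring.
by rewrite avg_sum; apply: eq_bigr => S _; rewrite avgZ.
Qed.

Lemma fourierM f g U : fourier (fun x => f x * g x) U =
  \sum_S \sum_T fourier f S * fourier g T * (symdiff S T == U)%:R.
Proof.
rewrite fourierE.
transitivity (avg (fun x => \sum_S \sum_T fourier f S * fourier g T *
    (chi R (symdiff S T) x * chi R U x))).
  apply: eq_avg => x; rewrite {1}(fourier_expansion f x) {1}(fourier_expansion g x).
  rewrite !big_distrl; apply: eq_bigr => S _ /=.
  rewrite -mulrA !big_distrl !big_distrr; apply: eq_bigr => T _ /=.
  by rewrite -chiM; ring.
rewrite avg_sum; apply: eq_bigr => S _; rewrite avg_sum; apply: eq_bigr => T _.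
by rewrite avgZ avg_chi.
Qed.

Definition upd (i : 'I_n) (b : bool) x : cube n :=
  [ffun j => if j == i then b else x j].

Lemma updE i b x j : upd i b x j = if j == i then b else x j.
Proof. by rewrite ffunE. Qed.

Lemma upd_upd i b c x : upd i b (upd i c x) = upd i b x.
Proof. by apply/ffunP => j; rewrite !updE; case: eqP. Qed.

Lemma updC i j b c x : i != j -> upd i b (upd j c x) = upd j c (upd i b x).
Proof.
move=> ij; apply/ffunP => l; rewrite !updE.
by case: (l =P i) => [->|//]; rewrite (negbTE ij).
Qed.

Lemma upd_id i x : upd i (x i) x = x.
Proof. by apply/ffunP => j; rewrite updE; case: eqP => [->|]. Qed.

Lemma avg_upd i f :
  avg f = (avg (fun x => f (upd i false x)) + avg (fun x => f (upd i true x))) / 2.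
Proof.
pose flip x := upd i (~~ x i) x.
have flipK : involutive flip.
  by move=> x; rewrite /flip updE eqxx upd_upd negbK upd_id.
have -> : avg (fun x => f (upd i false x)) + avg (fun x => f (upd i true x)) =
    avg f + avg (fun x => f (flip x)).
  rewrite -!avgD; apply: eq_avg => x; rewrite /flip.
  have := upd_id i x; case: (x i) => /= xE.
    by rewrite xE addrC.
  by rewrite xE.
have -> : avg (fun x => f (flip x)) = avg f.
  rewrite /avg [in LHS](reindex_inj (inv_inj flipK)) /=.
  by under eq_bigr do rewrite flipK.
by field.
Qed.

Lemma avg_upd_le i b f : (forall x, 0 <= f x) ->
  avg (fun x => f (upd i b x)) <= 2 * avg f.
Proof.
move=> f0; rewrite (avg_upd i f).
have h0 : 0 <= avg (fun x => f (upd i false x)) by apply: avg_ge0.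
have h1 : 0 <= avg (fun x => f (upd i true x)) by apply: avg_ge0.
by case: b; lra.
Qed.

Lemma sg_upd i b x : sg i (upd i b x) = (-1) ^+ b.
Proof. by rewrite /sg updE eqxx. Qed.

Lemma sg_upd_neq i j b x : i != j -> sg i (upd j b x) = sg i x.
Proof. by move=> ij; rewrite /sg updE (negbTE ij). Qed.

Lemma chi_upd i b S x : i \notin S -> chi R S (upd i b x) = chi R S x.
Proof.
move=> iS; apply: eq_bigr => j jS; rewrite updE.
by case: eqP => // ji; rewrite ji (negbTE iS) in jS.
Qed.

Lemma avg_sg i f : (forall b x, f (upd i b x) = f x) ->
  avg (fun x => sg i x * f x) = 0.
Proof.
move=> fi; rewrite (avg_upd i) -[X in _ + X]opprK -avgN.
rewrite [X in X - _](@eq_avg _ f) => [|x]; last by rewrite sg_upd fi expr0 mul1r.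
rewrite [X in _ - X](@eq_avg _ f) => [|x]; last first.
  by rewrite sg_upd fi expr1 mulN1r opprK.
by rewrite subrr mul0r.
Qed.

Lemma fourier_upd_in i b f S : i \in S -> fourier (fun x => f (upd i b x)) S = 0.
Proof.
move=> iS; rewrite fourierE.
rewrite (@eq_avg _ (fun x => sg i x * (f (upd i b x) * chi R (S :\ i) x))).
  by apply: avg_sg => c x; rewrite upd_upd chi_upd // !inE eqxx.
by move=> x; rewrite (chi_setD1 x iS); ring.
Qed.

Lemma fourier_upd_notin i b f S : i \notin S ->
  fourier (fun x => f (upd i b x)) S = fourier f S + (-1) ^+ b * fourier f (i |: S).
Proof.
move=> iS; rewrite !fourierE -avgZ -avgD.
rewrite [RHS](avg_upd i) -avgD mulrC -avgZ; apply: eq_avg => x.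
rewrite !chi_setU1 // !sg_upd !chi_upd //.
by case: b => /=; rewrite ?expr0 ?expr1; field.
Qed.

Definition depends_on D f := forall x y, {in D, x =1 y} -> f x = f y.

Lemma depends_on_upd D i b f :
  depends_on D f -> depends_on (D :\ i) (fun x => f (upd i b x)).
Proof.
move=> fD x y xy; apply: fD => j jD; rewrite !updE; case: eqP => // /eqP ji.
by apply: xy; rewrite !inE ji.
Qed.

Lemma upd_depends_on D i b f x : depends_on D f -> i \notin D ->
  f (upd i b x) = f x.
Proof.
move=> fD iD; apply: fD => j jD; rewrite updE.
by case: eqP => // ji; rewrite ji (negbTE iD) in jD.
Qed.

Definition merge J x y : cube n := [ffun i => if i \in J then y i else x i].

Lemma mergeE J x y i : merge J x y i = if i \in J then y i else x i.
Proof. by rewrite ffunE. Qed.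

(** Swapping the coordinates in [J] between two independent uniform points is an involution of the
    product of the two cubes. *)
Lemma avg_merge J f : avg f = avg (fun x => avg (fun y => f (merge J x y))).
Proof.
pose sw (p : cube n * cube n) := (merge J p.1 p.2, merge J p.2 p.1).
have swK : involutive sw.
  move=> [x y]; rewrite /sw /=; congr (_, _); apply/ffunP => i;
  by rewrite !mergeE; case: (i \in J).
transitivity ((\sum_p f (sw p).1) / 2 ^+ n / 2 ^+ n); last first.
  by rewrite /avg -big_distrl /= pair_big.
rewrite (reindex_inj (inv_inj swK)).
under eq_bigr do rewrite swK.
rewrite -(pair_big xpredT xpredT (fun x y => f x)) /=.
under eq_bigr do
  rewrite sumr_const card_ffun card_bool card_ord -[_ *+ (2 ^ n)]mulr_natr natrX.
by rewrite -big_distrl /= mulfK ?gt_eqF.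
Qed.

Lemma chi_merge_notin J T x y : [disjoint T & J] ->
  chi R T (merge J x y) = chi R T x.
Proof.
by move=> TJ; apply: eq_bigr => i iT; rewrite mergeE (disjointFr TJ iT).
Qed.

End CubeMean.

(** By Lagrange's identity. *)
Lemma sumr_cauchy_schwarz (R : realType) (I : finType) (a b : I -> R) :
  (\sum_i a i * b i) ^+ 2 <= (\sum_i a i ^+ 2) * (\sum_i b i ^+ 2).
Proof.
rewrite -subr_ge0.
have -> : (\sum_i a i ^+ 2) * (\sum_i b i ^+ 2) - (\sum_i a i * b i) ^+ 2 =
    (\sum_i \sum_j (a i * b j - a j * b i) ^+ 2) / 2.
  have -> : \sum_i \sum_j (a i * b j - a j * b i) ^+ 2 =
      \sum_i \sum_j (a i ^+ 2 * b j ^+ 2) + \sum_i \sum_j (b i ^+ 2 * a j ^+ 2)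
      - 2 * \sum_i \sum_j ((a i * b i) * (a j * b j)).
    rewrite big_distrr -!big_split -sumrB; apply: eq_bigr => i _ /=.
    rewrite big_distrr -!big_split -sumrB; apply: eq_bigr => j _ /=.
    by ring.
  have E (u v : I -> R) : \sum_i \sum_j u i * v j = (\sum_i u i) * (\sum_j v j).
    by rewrite big_distrlr.
  by rewrite !E; field.
by apply: divr_ge0 => //; do 2! (apply: sumr_ge0 => ? _); apply: sqr_ge0.
Qed.

(** Minkowski's inequality, phrased without square roots of sums. *)
Lemma sum_sqrD_le (R : realType) (I : finType) (a b : I -> R) (A B : R) :
  0 <= A -> 0 <= B -> \sum_i a i ^+ 2 <= A ^+ 2 -> \sum_i b i ^+ 2 <= B ^+ 2 ->
  \sum_i (a i + b i) ^+ 2 <= (A + B) ^+ 2.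
Proof.
move=> A0 B0 hA hB.
have -> : \sum_i (a i + b i) ^+ 2 =
    \sum_i a i ^+ 2 + \sum_i b i ^+ 2 + 2 * \sum_i a i * b i.
  by rewrite big_distrr -!big_split; apply: eq_bigr => i _ /=; ring.
have hab : \sum_i a i * b i <= A * B.
  apply: le_trans (ler_norm _) _.
  rewrite -(@ler_pXn2r _ 2) ?nnegrE ?normr_ge0 ?mulr_ge0 //.
  rewrite real_normK ?num_real // exprMn.
  apply: le_trans (sumr_cauchy_schwarz a b) _.
  by apply: ler_pM => //; apply: sumr_ge0 => i _; apply: sqr_ge0.
by rewrite sqrrD; lra.
Qed.

(** * The level-1 inequality *)

Section LevelOne.
Variables (R : realType) (n : nat).
Implicit Types (p h : cube n -> R) (D : {set 'I_n}).

(** Induction on [D], splitting along a coordinate [i]: the coefficient at [i] is half the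
    difference of the means on the two faces, the other coefficients are averages over the faces and
    are bounded by Minkowski. The two contributions add up by [bell_two_point]. *)
Lemma level1_bell (l0 : R) D h : 100 <= l0 -> (forall x, 0 <= h x <= 1) ->
  depends_on D h ->
  \sum_(i in D) avg (fun x => h x * sg R i x) ^+ 2 <= bell l0 (avg h) ^+ 2.
Proof.
move=> l100; have [m] := ubnP #|D|; elim: m D h => // m IH D h Dm h01 hD.
have [->|/set0Pn[i iD]] := eqVneq D set0.
  by rewrite big_set0 sqr_ge0.
pose h0 x := h (upd i false x); pose h1 x := h (upd i true x).
have avg01 (g : cube n -> R) : (forall x, 0 <= g x <= 1) -> 0 <= avg g <= 1.
  move=> g01; apply/andP; split; first by apply: avg_ge0 => x; case/andP: (g01 x).
  by rewrite -[leRHS](@avg_cst R n 1); apply: le_avg => x; case/andP: (g01 x).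
have h0b x : 0 <= h0 x <= 1 by apply: h01.
have h1b x : 0 <= h1 x <= 1 by apply: h01.
have cD : (#|D :\ i| < m)%N by move: Dm; rewrite (cardsD1 i) iD.
have IH0 := IH _ _ cD h0b (@depends_on_upd _ _ _ i false _ hD).
have IH1 := IH _ _ cD h1b (@depends_on_upd _ _ _ i true _ hD).
rewrite (bigD1 i) //=.
have -> : avg (fun x => h x * sg R i x) = (avg h0 - avg h1) / 2.
  rewrite (avg_upd i) -avgN; congr ((_ + _) / 2); apply: eq_avg => x;
  by rewrite sg_upd ?expr0 ?expr1 ?mulr1 ?mulrN1.
pose v0 j := if j \in D :\ i then avg (fun x => h0 x * sg R j x) / 2 else 0.
pose v1 j := if j \in D :\ i then avg (fun x => h1 x * sg R j x) / 2 else 0.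
have hv : \sum_(j in D | j != i) avg (fun x => h x * sg R j x) ^+ 2 =
    \sum_j (v0 j + v1 j) ^+ 2.
  rewrite big_mkcond; apply: eq_bigr => j _; rewrite /v0 /v1 !inE andbC.
  case: ifP => [/andP[ji jD]|_]; last by rewrite addr0 expr0n.
  congr (_ ^+ 2); rewrite [LHS](avg_upd i) -[RHS]mulrDl.
  by congr ((_ + _) / 2); apply: eq_avg => x; rewrite sg_upd_neq.
have b0 : 0 <= bell l0 (avg h0) / 2.
  by apply: divr_ge0 => //; apply: bell_ge0; case/andP: (avg01 _ h0b).
have b1 : 0 <= bell l0 (avg h1) / 2.
  by apply: divr_ge0 => //; apply: bell_ge0; case/andP: (avg01 _ h1b).
have sv (g : cube n -> R) : \sum_j (if j \in D :\ i then
      avg (fun x => g x * sg R j x) / 2 else 0) ^+ 2 =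
    (\sum_(j in D :\ i) avg (fun x => g x * sg R j x) ^+ 2) / 4.
  rewrite big_distrl [RHS]big_mkcond; apply: eq_bigr => j _ /=.
  by case: ifP => _; [field | rewrite expr0n].
have le0 : \sum_j v0 j ^+ 2 <= (bell l0 (avg h0) / 2) ^+ 2.
  by rewrite sv exprMn exprVn -natrX ler_pM2r.
have le1 : \sum_j v1 j ^+ 2 <= (bell l0 (avg h1) / 2) ^+ 2.
  by rewrite sv exprMn exprVn -natrX ler_pM2r.
rewrite hv.
have := sum_sqrD_le b0 b1 le0 le1.
have := bell_two_point l100 (avg01 _ h0b) (avg01 _ h1b).
rewrite (avg_upd i h) -/h0 -/h1 -mulrDl.
lra.
Qed.

(** The positive and negative parts of [p] are treated separately; their means sum to the mean of
    [|p|], hence the halved argument of [bell]. *)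
Lemma level1_signed (l0 : R) p : 100 <= l0 -> (forall x, `|p x| <= 1) ->
  \sum_i avg (fun x => p x * sg R i x) ^+ 2 <=
  (2 * bell l0 (avg (fun x => `|p x|) / 2)) ^+ 2.
Proof.
move=> l100 p1.
pose pp x := (`|p x| + p x) / 2; pose pm x := (`|p x| - p x) / 2.
have hpp x : 0 <= pp x <= 1.
  have := ler_norm (p x); have := ler_norm (- p x); rewrite normrN.
  by have := p1 x; rewrite /pp; lra.
have hpm x : 0 <= pm x <= 1.
  have := ler_norm (p x); have := ler_norm (- p x); rewrite normrN.
  by have := p1 x; rewrite /pm; lra.
have dT (g : cube n -> R) : depends_on setT g.
  by move=> x y xy; congr g; apply/ffunP => i; apply: xy.
have avg01 (g : cube n -> R) : (forall x, 0 <= g x <= 1) -> 0 <= avg g <= 1.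
  move=> g01; apply/andP; split; first by apply: avg_ge0 => x; case/andP: (g01 x).
  by rewrite -[leRHS](@avg_cst R n 1); apply: le_avg => x; case/andP: (g01 x).
have Hp := level1_bell l100 hpp (dT pp).
have Hm := level1_bell l100 hpm (dT pm).
have eT (F : 'I_n -> R) : \sum_(i in [set: 'I_n]) F i = \sum_i F i.
  by apply: eq_bigl => i; rewrite inE.
rewrite !eT in Hp Hm.
have -> : \sum_i avg (fun x => p x * sg R i x) ^+ 2 =
    \sum_i (avg (fun x => pp x * sg R i x) + - avg (fun x => pm x * sg R i x)) ^+ 2.
  apply: eq_bigr => i _; rewrite -avgB; congr (_ ^+ 2); apply: eq_avg => x.
  by rewrite /pp /pm; field.
have bp : 0 <= bell l0 (avg pp) by apply: bell_ge0; case/andP: (avg01 _ hpp).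
have bm : 0 <= bell l0 (avg pm) by apply: bell_ge0; case/andP: (avg01 _ hpm).
apply: (@le_trans _ _ ((bell l0 (avg pp) + bell l0 (avg pm)) ^+ 2)).
  apply: sum_sqrD_le => //.
  by under eq_bigr do rewrite sqrrN.
have := bell_midpoint l100 (avg01 _ hpp) (avg01 _ hpm).
have -> : avg pp + avg pm = avg (fun x => `|p x|).
  by rewrite -avgD; apply: eq_avg => x; rewrite /pp /pm; field.
by move=> h; apply: lerXn2r; rewrite ?nnegrE //; lra.
Qed.

End LevelOne.

(** * Moments of low-degree polynomials *)

Section Pairing.
Variables (R : realType) (n : nat).
Implicit Types (c : {set 'I_n} -> R) (S T : {set 'I_n}) (f g : cube n -> R).

Definition ev c (x : cube n) : R := \sum_S c S * chi R S x.

Definition homog d c := forall S, c S != 0 -> #|S| = d.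

(** Coefficients of the discrete derivative in direction [e], the factor that multiplies [sg e]. *)
Definition dcoef (e : 'I_n) c : {set 'I_n} -> R :=
  fun T => if e \in T then 0 else c (e |: T).

Definition nrm2 c : R := \sum_S c S ^+ 2.

(** A nonnegative spectrum survives products and forces a nonnegative mean; this justifies adding
    terms to an upper bound for a mean. *)
Definition pos f := forall S, 0 <= fourier f S.

Lemma fourier_ev c S : fourier (ev c) S = c S.
Proof. exact: fourier_unique. Qed.

Lemma pos_ev c : (forall S, 0 <= c S) -> pos (ev c).
Proof. by move=> c0 S; rewrite fourier_ev. Qed.

Lemma posM f g : pos f -> pos g -> pos (fun x => f x * g x).
Proof.
move=> pf pg U; rewrite fourierM; do 2! (apply: sumr_ge0 => ? _).
by apply: mulr_ge0 (ler0n _ _); apply: mulr_ge0.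
Qed.

Lemma pos1 : pos (fun=> 1).
Proof.
move=> S; have -> : fourier (fun=> 1) S = (set0 == S)%:R :> R.
  by rewrite -avg_chi; apply: eq_avg => x; rewrite chi0 !mul1r.
exact: ler0n.
Qed.

Lemma pos_prod (I : Type) (r : seq I) (P : pred I) (F : I -> cube n -> R) :
  (forall i, pos (F i)) -> pos (fun x => \prod_(i <- r | P i) F i x).
Proof.
move=> pF; elim: r => [|i r IH].
  by move=> S; rewrite (_ : fourier _ S = fourier (fun=> 1) S);
    [exact: pos1 | apply: eq_avg => x; rewrite big_nil].
have [Pi|Pi] := boolP (P i).
  move=> S; rewrite (_ : fourier _ S =
    fourier (fun x => F i x * \prod_(j <- r | P j) F j x) S);
    [exact: posM | by apply: eq_avg => x; rewrite big_cons Pi].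
move=> S; rewrite (_ : fourier _ S =
    fourier (fun x => \prod_(j <- r | P j) F j x) S); first exact: IH.
by apply: eq_avg => x; rewrite big_cons (negbTE Pi).
Qed.

Lemma pos_avg f : pos f -> 0 <= avg f.
Proof. by rewrite avg_set0. Qed.

Lemma pos_sg e f : pos f -> pos (fun x => sg R e x * f x).
Proof.
move=> pf; apply: posM => // S.
have -> : fourier (sg R e) S = ([set e] == S)%:R.
  rewrite -avg_chi; apply: eq_avg => x.
  by rewrite -[ [set e] ]setU0 chi_setU1 ?inE // chi0 mulr1.
exact: ler0n.
Qed.

Lemma dcoef_homog e d c : homog d.+1 c -> homog d (dcoef e c).
Proof.
move=> hc T; rewrite /dcoef; case: ifPn => [_|eT /hc]; first by rewrite eqxx.
by rewrite cardsU1 eT add1n => -[].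
Qed.

Lemma dcoef_homog0 e c T : homog 0 c -> dcoef e c T = 0.
Proof.
move=> hc; rewrite /dcoef; case: ifPn => // eT; apply/eqP.
by apply: contraT => /hc; rewrite cardsU1 eT.
Qed.

Lemma dcoef_ge0 e c : (forall S, 0 <= c S) -> forall S, 0 <= dcoef e c S.
Proof. by move=> c0 S; rewrite /dcoef; case: ifP. Qed.

Lemma sum_setU1 e (F : {set 'I_n} -> R) :
  \sum_(T : {set 'I_n} | e \notin T) F (e |: T) = \sum_(S : {set 'I_n} | e \in S) F S.
Proof.
rewrite [RHS](reindex_onto (fun T => e |: T) (fun S => S :\ e)) /=; last first.
  by move=> S eS; rewrite setD1K.
apply: eq_bigl => T; rewrite setU11 /=.
have [eT|eT] := boolP (e \in T); last by rewrite setU1K // eqxx.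
by apply/esym/negbTE/eqP => TE; move: eT; rewrite -TE !inE eqxx.
Qed.

Lemma sum_dcoef (e : 'I_n) c (G : R -> {set 'I_n} -> R) : (forall T, G 0 T = 0) ->
  \sum_T G (dcoef e c T) (e |: T) = \sum_(S : {set 'I_n} | e \in S) G (c S) S.
Proof.
move=> G0; rewrite -sum_setU1 [RHS]big_mkcond; apply: eq_bigr => T _.
by rewrite /dcoef; case: (e \in T) => /=; rewrite ?G0.
Qed.

Lemma sum_elements d c (G : R -> {set 'I_n} -> R) : homog d c ->
  (forall T, G 0 T = 0) ->
  \sum_e \sum_(S : {set 'I_n} | e \in S) G (c S) S = d%:R * \sum_S G (c S) S.
Proof.
move=> hc G0; under eq_bigr do rewrite big_mkcond.
rewrite exchange_big big_distrr; apply: eq_bigr => S _ /=.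
rewrite -big_mkcond /= sumr_const -[LHS]mulr_natl.
have [->|/hc ->//] := eqVneq (c S) 0.
by rewrite G0 !mulr0.
Qed.

(** Euler's identity for homogeneous polynomials: each monomial is counted once per element of its
    set. *)
Lemma ev_euler d c x : homog d c ->
  d%:R * ev c x = \sum_e sg R e x * ev (dcoef e c) x.
Proof.
move=> hc.
rewrite /ev -(@sum_elements d c (fun a S => a * chi R S x)) //; last first.
  by move=> T; rewrite mul0r.
apply: eq_bigr => e _.
rewrite -(@sum_dcoef e c (fun a S => a * chi R S x)) => [|T]; last by rewrite mul0r.
rewrite big_distrr; apply: eq_bigr => T _ /=; rewrite /dcoef.
case: ifPn => eT; first by rewrite !mul0r mulr0.
by rewrite chi_setU1 //; ring.
Qed.

Lemma sum_nrm2_dcoef d c : homog d c ->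
  \sum_e nrm2 (dcoef e c) = d%:R * nrm2 c.
Proof.
move=> hc; rewrite /nrm2 -(@sum_elements d c (fun a _ => a ^+ 2)) //; last first.
  by move=> _; rewrite expr0n.
apply: eq_bigr => e _; rewrite -(@sum_dcoef e c (fun a _ => a ^+ 2)) // => _.
by rewrite expr0n.
Qed.

Definition efree e c : {set 'I_n} -> R := fun S => if e \in S then 0 else c S.

Lemma ev_split e c x : ev c x = sg R e x * ev (dcoef e c) x + ev (efree e c) x.
Proof.
rewrite /ev (bigID (fun S : {set 'I_n} => e \in S)) /=; congr (_ + _).
  rewrite -(@sum_dcoef e c (fun a S => a * chi R S x)) => [|T]; last by rewrite mul0r.
  rewrite big_distrr; apply: eq_bigr => T _ /=; rewrite /dcoef.
  case: ifPn => eT; first by rewrite !mul0r mulr0.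
  by rewrite chi_setU1 //; ring.
rewrite big_mkcond; apply: eq_bigr => S _; rewrite /efree.
by case: (e \in S) => //=; rewrite mul0r.
Qed.

Lemma ev_free e b c x : (forall S, e \in S -> c S = 0) ->
  ev c (upd e b x) = ev c x.
Proof.
move=> c0; apply: eq_bigr => S _.
have [eS|eS] := boolP (e \in S); first by rewrite c0 // !mul0r.
by rewrite chi_upd.
Qed.

Lemma ev_dcoef_free e b c x : ev (dcoef e c) (upd e b x) = ev (dcoef e c) x.
Proof. by apply: ev_free => S eS; rewrite /dcoef eS. Qed.

(* A factor [sg e] has to meet a factor of the product containing [e]. *)
Lemma avg_pair_le (I : eqType) (s : seq I) (e : 'I_n) (A : cube n -> R)
    (c : I -> {set 'I_n} -> R) : uniq s ->
  (forall i S, 0 <= c i S) -> pos A -> (forall b x, A (upd e b x) = A x) ->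
  avg (fun x => sg R e x * (A x * \prod_(i <- s) ev (c i) x)) <=
  \sum_(v <- s) avg (fun x => A x * (ev (dcoef e (c v)) x *
    \prod_(i <- s | i != v) ev (c i) x)).
Proof.
move=> us c0; elim: s us A => [|i s IH] /= us A pA Ae.
  rewrite big_nil (@eq_avg _ _ _ (fun x => sg R e x * A x)).
    by rewrite avg_sg.
  by move=> x; rewrite big_nil mulr1.
have [is_ us'] := andP us.
rewrite big_cons.
have -> : avg (fun x => sg R e x * (A x * \prod_(j <- i :: s) ev (c j) x)) =
  avg (fun x => A x * (ev (dcoef e (c i)) x * \prod_(j <- s) ev (c j) x)) +
  avg (fun x => sg R e x * (A x * ev (efree e (c i)) x * \prod_(j <- s) ev (c j) x)).
  rewrite -avgD; apply: eq_avg => x; rewrite big_cons (ev_split e (c i)).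
  rewrite -[in RHS](mul1r (A x * (_ * _))) -(sg_sqr R e x); ring.
apply: lerD.
  rewrite le_eqVlt; apply/orP; left; apply/eqP; apply: eq_avg => x.
  rewrite big_cons eqxx /=; congr (_ * (_ * _)).
  rewrite big_seq [RHS]big_seq_cond; apply: eq_bigl => j.
  by have [js|] := boolP (j \in s) => //=; apply/esym; apply: contraNneq is_ => <-.
have pB : pos (fun x => A x * ev (efree e (c i)) x).
  by apply: posM => //; apply: pos_ev => S; rewrite /efree; case: ifP.
have Be b x : A (upd e b x) * ev (efree e (c i)) (upd e b x) =
    A x * ev (efree e (c i)) x.
  by rewrite Ae ev_free // => S eS; rewrite /efree eS.
apply: le_trans (IH us' _ pB Be) _.
rewrite [leLHS]big_seq [leRHS]big_seq; apply: ler_sum => v vs.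
have iv : i != v by apply: contraNneq is_ => ->.
(* The induction leaves [ev (efree e (c i))] in place of [ev (c i)]; the missing part has
   nonnegative spectrum, so restoring it can only increase the mean. *)
rewrite -subr_ge0 -avgB.
rewrite (@eq_avg _ _ _ (fun x => A x * (ev (dcoef e (c v)) x *
    ((sg R e x * ev (dcoef e (c i)) x) * \prod_(j <- s | j != v) ev (c j) x)))).
  apply: pos_avg; apply: posM => //; apply: posM.
    by apply: pos_ev; apply: dcoef_ge0.
  apply: posM; last by apply: pos_prod => j; apply: pos_ev.
  by apply: pos_sg; apply: pos_ev; apply: dcoef_ge0.
by move=> x; rewrite big_cons iv (ev_split e (c i)); ring.
Qed.

End Pairing.

(** * Counting loopless pairings of half-edges *)

Section PairingMoment.
Variables (R : realType) (n : nat).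

(* [M] vertices with [K] half-edges in total: the vertex processed first has
   at least [max 1 (K / M)] of them, none of which can be its partner. *)
Fixpoint pairings (M K : nat) {struct K} : R :=
  match K with
  | 0 => 1
  | 1 => 0
  | (K'.+1 as K1).+1 => (K%:R - Num.max 1 (K%:R / M%:R)) * pairings M K'
  end.

Lemma pairingsSS M K : pairings M K.+2 =
  (K.+2%:R - Num.max 1 (K.+2%:R / M%:R)) * pairings M K.
Proof. by []. Qed.

Lemma pairings_factor_ge0 (M K : nat) : (0 < M)%N ->
  0 <= K.+1%:R - Num.max 1 (K.+1%:R / M%:R) :> R.
Proof.
move=> M0; rewrite subr_ge0 ge_max ler1n /=.
by rewrite ler_pdivrMr ?ltr0n // -natrM ler_nat leq_pmulr.
Qed.

Lemma pairings_ge0 M K : (0 < M)%N -> 0 <= pairings M K.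
Proof.
move=> M0; have [m] := ubnP K; elim: m K => // m IH [|[|K]] // Km.
rewrite pairingsSS; apply: mulr_ge0; first exact: pairings_factor_ge0.
by apply: IH; rewrite ltnS in Km; apply: leq_trans Km; apply: leqW.
Qed.

(** For [homog d c] this is the Hilbert-Schmidt norm of the symmetric [d]-tensor that represents
    [ev c], whose nonzero entries are the [c S / d!]. *)
Definition hnorm (d : nat) (c : {set 'I_n} -> R) : R := Num.sqrt (nrm2 c / d`!%:R).

Lemma nrm2_ge0 (c : {set 'I_n} -> R) : 0 <= nrm2 c.
Proof. by apply: sumr_ge0 => S _; apply: sqr_ge0. Qed.

Lemma hnorm_ge0 d c : 0 <= hnorm d c. Proof. exact: sqrtr_ge0. Qed.

Lemma hnorm_sqr d c : hnorm d c ^+ 2 = nrm2 c / d`!%:R.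
Proof. by rewrite sqr_sqrtr // divr_ge0 // nrm2_ge0. Qed.

(** Cauchy-Schwarz over [e]. In this normalization, joining two vertices by an edge costs exactly
    the number of ways to choose one half-edge at each. *)
Lemma sum_hnorm_dcoef d d' (c c' : {set 'I_n} -> R) :
  homog d.+1 c -> homog d'.+1 c' ->
  \sum_e hnorm d (dcoef e c) * hnorm d' (dcoef e c') <=
  d.+1%:R * hnorm d.+1 c * (d'.+1%:R * hnorm d'.+1 c').
Proof.
have sumE k (g : {set 'I_n} -> R) : homog k.+1 g ->
    \sum_e hnorm k (dcoef e g) ^+ 2 = (k.+1%:R * hnorm k.+1 g) ^+ 2.
  move=> hg; under eq_bigr do rewrite hnorm_sqr.
  rewrite -big_distrl /= (sum_nrm2_dcoef hg) exprMn hnorm_sqr factS natrM.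
  by field; rewrite [1 + _]addrC natr1 !pnatr_eq0 -lt0n fact_gt0.
move=> hc hc'.
rewrite -(@ler_pXn2r _ 2) ?nnegrE //.
- apply: le_trans (sumr_cauchy_schwarz _ _) _.
  by rewrite (sumE _ _ hc) (sumE _ _ hc') -exprMn.
- by apply: sumr_ge0 => e _; rewrite mulr_ge0 ?hnorm_ge0.
- by rewrite !mulr_ge0 ?hnorm_ge0.
Qed.

(** Induction on the total degree [K]. Euler's identity extracts a half-edge at a vertex [a] of
    maximal degree, [avg_pair_le] supplies a partner at some [v != a], and [sum_hnorm_dcoef] bounds
    the sum over labels. This yields the factor [K - k a], where [k a] is at least [1] and at least
    the average degree. *)
Lemma avg_prod_le (I : finType) (c : I -> {set 'I_n} -> R) (k : I -> nat) :
  (forall i S, 0 <= c i S) -> (forall i, homog (k i) (c i)) ->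
  avg (fun x => \prod_i ev (c i) x) <=
  pairings #|I| (\sum_i k i) * \prod_i hnorm (k i) (c i).
Proof.
have [m] := ubnP (\sum_i k i); elim: m c k => // m IH c k Km c0 hc.
have [K0|] := eqVneq (\sum_i k i)%N 0%N.
  have k0 i : k i = 0%N.
    by move/eqP: K0; rewrite sum_nat_eq0 => /forallP /(_ i) /eqP.
  rewrite K0 mul1r -[leRHS](@avg_cst R n); apply: le_avg => x.
  apply: ler_prod => i _.
  have cE S : S != set0 -> c i S = 0.
    move=> S0; apply/eqP; apply: contraT => /hc.
    by rewrite k0 => /eqP; rewrite cards_eq0 (negbTE S0).
  have -> : ev (c i) x = c i set0.
    rewrite /ev (bigD1 set0) //= chi0 mulr1 big1 ?addr0 // => S S0.
    by rewrite cE // mul0r.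
  rewrite c0 /= /hnorm k0 fact0 divr1 /nrm2 (bigD1 set0) //= big1 ?addr0.
    by rewrite sqrtr_sqr ger0_norm.
  by move=> S S0; rewrite cE // expr0n.
rewrite -lt0n => Kpos.
have I0 : (0 < #|I|)%N.
  rewrite lt0n; apply: contraTneq Kpos => I0.
  by rewrite big_pred0 // => i; have := card0_eq I0 i; rewrite !inE.
have [a amax] : exists a, forall i, (k i <= k a)%N.
  have [i0 _] : exists i0 : I, true by case/card_gt0P: I0 => i0; exists i0.
  by case: (@arg_maxnP I i0 xpredT k) => // a _ ha; exists a => i; apply: ha.
set K := (\sum_i k i)%N in Km Kpos *.
have Kle : (K <= #|I| * k a)%N.
  rewrite -sum_nat_const; exact: leq_sum.
have ka0 : (0 < k a)%N.
  by rewrite lt0n; apply: contraTneq Kpos => ka; rewrite -leqNgt; rewrite ka muln0 in Kle.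
have [d ka] : exists d, k a = d.+1 by exists (k a).-1; rewrite prednK.
have hca : homog d.+1 (c a) by rewrite -ka.
pose rest v x := \prod_(i | (i != a) && (i != v)) ev (c i) x.
have step1 : (k a)%:R * avg (fun x => \prod_i ev (c i) x) <=
    \sum_(v | v != a) \sum_e
      avg (fun x => ev (dcoef e (c a)) x * (ev (dcoef e (c v)) x * rest v x)).
  rewrite -avgZ exchange_big /=.
  rewrite (@eq_avg _ _ _ (fun x => \sum_e sg R e x * (ev (dcoef e (c a)) x *
     \prod_(i <- [seq i <- enum I | i != a]) ev (c i) x))); last first.
    move=> x; rewrite (bigD1 a) //= mulrA ka (ev_euler x hca) big_distrl /=.
    apply: eq_bigr => e _; rewrite -mulrA; congr (_ * (_ * _)).
    by rewrite big_filter big_enum_cond.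
  rewrite avg_sum; apply: ler_sum => e _.
  apply: le_trans (@avg_pair_le _ _ _ _ e _ c _ c0 _ _) _.
  - by rewrite filter_uniq // enum_uniq.
  - by apply: pos_ev; apply: dcoef_ge0.
  - by move=> b x; rewrite ev_dcoef_free.
  rewrite le_eqVlt; apply/orP; left; apply/eqP.
  rewrite big_filter big_enum_cond /=; apply: eq_bigr => v va.
  apply: eq_avg => x; congr (_ * (_ * _)).
  by rewrite big_filter_cond big_enum_cond.
pose Q := \prod_i hnorm (k i) (c i).
have Q0 : 0 <= Q by apply: prodr_ge0 => i _; apply: hnorm_ge0.
have step2 v : v != a -> \sum_e
      avg (fun x => ev (dcoef e (c a)) x * (ev (dcoef e (c v)) x * rest v x)) <=
    pairings #|I| (K - 2) * ((k a)%:R * (k v)%:R * Q).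
  move=> va.
  have [kv0|] := posnP (k v).
    rewrite kv0 mulr0 mul0r mulr0 big1 // => e _.
    rewrite -[RHS](@avg_cst R n); apply: eq_avg => x.
    have -> : ev (dcoef e (c v)) x = 0.
      rewrite /ev big1 // => S _; rewrite dcoef_homog0 ?mul0r //.
      by rewrite -kv0.
    by rewrite mul0r mulr0.
  move=> kv_gt0; have [d' kv] : exists d', k v = d'.+1 by exists (k v).-1; rewrite prednK.
  have hcv : homog d'.+1 (c v) by rewrite -kv.
  pose k' i := if (i == a) || (i == v) then (k i).-1 else k i.
  have KE : (\sum_i k' i = K - 2)%N.
    rewrite /K (bigD1 a) //= (bigD1 v) //= [X in (_ = X - 2)%N](bigD1 a) //=.
    rewrite [X in (_ = _ + X - 2)%N](bigD1 v) //=.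
    rewrite {1 2}/k' !eqxx orbT /= ka kv /=.
    rewrite (eq_bigr k) => [|i /andP[ia iv]]; first by rewrite addSn addSn addnS subn2.
    by rewrite /k' (negbTE ia) (negbTE iv).
  have K2 : (K - 2 < m)%N.
    have aux (u w : nat) : (0 < u)%N -> (u < w.+1)%N -> (u - 2 < w)%N by lia.
    exact: aux.
  pose P := \prod_(i | (i != a) && (i != v)) hnorm (k i) (c i).
  have P0 : 0 <= P by apply: prodr_ge0 => i _; apply: hnorm_ge0.
  have each e : avg (fun x => ev (dcoef e (c a)) x * (ev (dcoef e (c v)) x * rest v x)) <=
      pairings #|I| (K - 2) * P * (hnorm d (dcoef e (c a)) * hnorm d' (dcoef e (c v))).
    pose c' i := if (i == a) || (i == v) then dcoef e (c i) else c i.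
    have c'0 i S : 0 <= c' i S by rewrite /c'; case: ifP => _ //; apply: dcoef_ge0.
    have hc' i : homog (k' i) (c' i).
      rewrite /k' /c'; case: ifP => [/orP[]/eqP->|_ //].
        by rewrite ka; apply: dcoef_homog.
      by rewrite kv; apply: dcoef_homog.
    have prodE : \prod_i hnorm (k' i) (c' i) =
        hnorm d (dcoef e (c a)) * (hnorm d' (dcoef e (c v)) * P).
      rewrite (bigD1 a) //= (bigD1 v) //=.
      rewrite {1 2}/c' {1 2}/k' !eqxx orbT /= ka kv /=; congr (_ * (_ * _)).
      by apply: eq_bigr => i /andP[ia iv]; rewrite /k' /c' (negbTE ia) (negbTE iv).
    have := IH c' k'; rewrite KE prodE => /(_ K2 c'0 hc') h.
    rewrite (@eq_avg _ _ _ (fun x => \prod_i ev (c' i) x)).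
      by apply: le_trans h _; rewrite le_eqVlt; apply/orP; left; apply/eqP; ring.
    move=> x; rewrite [RHS](bigD1 a) //= (bigD1 v) //=.
    rewrite {1 2}/c' !eqxx orbT /=; congr (_ * (_ * _)).
    by apply: eq_bigr => i /andP[ia iv]; rewrite /c' (negbTE ia) (negbTE iv).
  apply: le_trans (ler_sum _ (fun e _ => each e)) _.
  rewrite -big_distrr /= -[leLHS]mulrA; apply: ler_wpM2l; first exact: pairings_ge0.
  have := sum_hnorm_dcoef hca hcv => /(ler_wpM2l P0) h.
  apply: le_trans h _; rewrite /Q (bigD1 a) //= (bigD1 v) //= -/P ka kv.
  by rewrite le_eqVlt; apply/orP; left; apply/eqP; ring.
have step3 : avg (fun x => \prod_i ev (c i) x) <=
    (K - k a)%:R * pairings #|I| (K - 2) * Q.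
  rewrite -(@ler_pM2l _ (k a)%:R) ?ltr0n //.
  apply: le_trans step1 (le_trans (ler_sum _ step2) _).
  rewrite -big_distrr -big_distrl -big_distrr /= -natr_sum.
  have -> : (\sum_(v | v != a) k v = K - k a)%N.
    by rewrite /K [X in (_ = X - _)%N](bigD1 a) //= addKn.
  by rewrite le_eqVlt; apply/orP; left; apply/eqP; ring.
apply: le_trans step3 _; rewrite -/Q; apply: ler_wpM2r => //.
have kaK : (k a <= K)%N by rewrite /K (bigD1 a) //= leq_addr.
(* For [K = 1] the only half-edge has no partner, and both sides vanish. *)
move: (K) Kpos Kle kaK => [|[|K']] // _ Kle kaK.
  have -> : k a = 1%N by apply/eqP; rewrite eqn_leq kaK.
  by rewrite subnn mul0r.
rewrite pairingsSS subn2 /=; apply: ler_wpM2r; first exact: pairings_ge0.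
rewrite natrB // lerD2l lerN2 ge_max ler1n ka0 /=.
by rewrite ler_pdivrMr ?ltr0n // -natrM ler_nat mulnC.
Qed.

(* The vector-valued case follows by expanding the power of the sum of squares. *)
Lemma avg_sum_sqr_pow_le (d r : nat) (c : 'I_n -> {set 'I_n} -> R) :
  (forall j, homog d (c j)) ->
  avg (fun x => (\sum_j ev (c j) x ^+ 2) ^+ r) <=
  pairings (2 * r) (2 * r * d) * ((\sum_j nrm2 (c j)) / d`!%:R) ^+ r.
Proof.
move=> hc.
have powE (a : 'I_n -> R) : (\sum_j a j) ^+ r =
    \sum_(f : {ffun 'I_r -> 'I_n}) \prod_l a (f l).
  by rewrite -(bigA_distr_bigA (fun _ j => a j)) prodr_const card_ord.
rewrite (@eq_avg _ _ _ (fun x => \sum_(f : {ffun 'I_r -> 'I_n})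
   \prod_l ev (c (f l)) x ^+ 2)); last by move=> x; rewrite powE.
rewrite avg_sum big_distrl powE big_distrr /=; apply: ler_sum => f _.
(* The boolean duplicates each factor: a product of [r] squares becomes a product over [2 r]
   vertices. *)
pose I : finType := ('I_r * bool)%type.
pose ca (p : I) S := `|c (f p.1) S|.
have hca p : homog d (ca p).
  by move=> S; rewrite normr_eq0; apply: hc.
have := @avg_prod_le I ca (fun=> d) (fun p S => normr_ge0 _) hca.
have cI : #|I| = (2 * r)%N by rewrite card_prod card_ord card_bool mulnC.
rewrite sum_nat_const cI.
have prodE (F : 'I_r -> R) : \prod_(p : I) F p.1 = \prod_l F l ^+ 2.
  rewrite -(pair_big xpredT xpredT (fun l (_ : bool) => F l)) /=.
  by apply: eq_bigr => l _; rewrite prodr_const card_bool.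
rewrite (prodE (fun l => hnorm d (ca (l, true)))).
rewrite (eq_bigr (fun l => nrm2 (c (f l)) / d`!%:R)); last first.
  move=> l _; rewrite hnorm_sqr; congr (_ / _).
  by apply: eq_bigr => S _; rewrite /ca real_normK ?num_real.
apply: le_trans.
rewrite (@eq_avg _ _ _ (fun x => \prod_(p : I) ev (c (f p.1)) x)); last first.
  by move=> x; rewrite (prodE (fun l => ev (c (f l)) x)).
(* Replacing the coefficients by their absolute values increases the mean. *)
have key (s : seq I) U : `|fourier (fun x => \prod_(p <- s) ev (c (f p.1)) x) U| <=
    fourier (fun x => \prod_(p <- s) ev (ca p) x) U.
  elim: s U => [|p s IH] U.
    rewrite (_ : fourier _ U = fourier (fun=> 1) U); last first.
      by apply: eq_avg => x; rewrite big_nil.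
    rewrite [leRHS](_ : _ = fourier (fun=> 1) U); last first.
      by apply: eq_avg => x; rewrite big_nil.
    by rewrite ger0_norm // pos1.
  rewrite (_ : fourier _ U = fourier (fun x => ev (c (f p.1)) x *
    \prod_(p <- s) ev (c (f p.1)) x) U); last first.
    by apply: eq_avg => x; rewrite big_cons.
  rewrite [leRHS](_ : _ = fourier (fun x => ev (ca p) x *
    \prod_(p <- s) ev (ca p) x) U); last first.
    by apply: eq_avg => x; rewrite big_cons.
  rewrite !fourierM; apply: le_trans (ler_norm_sum _ _ _) _; apply: ler_sum => S _.
  apply: le_trans (ler_norm_sum _ _ _) _; apply: ler_sum => T _.
  rewrite !fourier_ev normrM normr_nat (normrM (c (f p.1) S)).
  apply: ler_wpM2r; first exact: ler0n.
  exact: (ler_wpM2l (normr_ge0 _) (IH T)).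
rewrite !avg_set0; apply: le_trans (ler_norm _) _; exact: key.
Qed.

End PairingMoment.

(** * Asymptotic bounds for the number of pairings *)

Section PairingsBound.
Variable R : realType.

Lemma expR1_le4 : expR 1 <= 4 :> R.
Proof.
have h : 1 / 2 <= expR (- (1 / 2)) :> R.
  by apply: le_trans (expR_ge1Dx _); lra.
have e1 : expR (- (1 / 2)) * expR (1 / 2) = 1 :> R by rewrite -expRD addNr expR0.
have e2 : expR 1 = expR (1 / 2) ^+ 2 :> R by rewrite -expRM_natr; congr expR; field.
have e0 := expR_gt0 (1 / 2 : R).
have h2 : expR (1 / 2) <= 2 :> R by nra.
rewrite e2; nra.
Qed.

(** At [x = 1 / (2 i + 1)] the ratio [(1 + x) / (1 - x)] is [(i + 1) / i], with logarithm at least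
    [2 x]. *)
Lemma expR2_le_ratio (i : nat) : (0 < i)%N ->
  expR 2 <= (i.+1%:R / i%:R) ^+ (2 * i).+1 :> R.
Proof.
move=> i0; have iR : 0 < i%:R :> R by rewrite ltr0n.
pose x : R := (2 * i%:R + 1)^-1.
have x0 : 0 < x by rewrite invr_gt0; lra.
have x1 : x < 1 by rewrite invf_lt1; lra.
have := ln_ratio_ge (ltW x0) x1; rewrite -ln_div ?posrE; [|lra|lra].
have -> : (1 + x) / (1 - x) = i.+1%:R / i%:R.
  rewrite /x -[i.+1%:R]natr1; field.
  by rewrite (gt_eqF iR) /=; apply/andP; split; apply/eqP; lra.
have x3 : 0 <= x ^+ 3 by apply: exprn_ge0; lra.
move=> h; have {}h : 2 * x <= ln (i.+1%:R / i%:R) by lra.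
have p : 0 < i.+1%:R / i%:R :> R by rewrite divr_gt0 ?ltr0n.
rewrite -ler_expR lnK ?posrE // in h.
have -> : expR 2 = expR (2 * x) ^+ (2 * i).+1 :> R.
  rewrite -expRM_natr; congr expR.
  rewrite -[(2 * i).+1%:R]natr1 natrM /x.
  by field; apply/eqP; lra.
by apply: lerXn2r; rewrite ?nnegrE ?expR_ge0 // ltW.
Qed.

(** Stirling-type majorant of [(2^i i!)^2]. *)
Let s (i : nat) : R := expR 2 * i%:R * (2 * i%:R / expR 1) ^+ (2 * i).

Let s_step (i : nat) : (0 < i)%N -> (2 * i.+1%:R) ^+ 2 * s i <= s i.+1.
Proof.
move=> i0; have iR : 0 < i%:R :> R by rewrite ltr0n.
have e0 := expR_gt0 (1 : R).
rewrite /s.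
have -> : (2 * i.+1)%N = (2 * i).+2 by rewrite mulnS.
have E : (2 * i.+1%:R / expR 1) ^+ (2 * i).+2 =
    (2 * i.+1%:R) ^+ 2 / expR 2 * (2 * i%:R / expR 1) ^+ (2 * i) *
    (i.+1%:R / i%:R) ^+ (2 * i) :> R.
  have YE : 2 * i.+1%:R / expR 1 = 2 * i%:R / expR 1 * (i.+1%:R / i%:R) :> R.
    by field; rewrite !gt_eqF.
  have -> : expR 2 = expR 1 ^+ 2 :> R by rewrite -expRM_natr mul1r.
  transitivity ((2 * i%:R / expR 1 * (i.+1%:R / i%:R)) ^+ (2 * i) *
      (2 * i.+1%:R / expR 1) ^+ 2 : R); first by rewrite -YE -exprD addn2.
  by rewrite exprMn [X in _ * X = _]expr_div_n mulrC mulrA.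
rewrite E.
have A0 : 0 <= (2 * i.+1%:R) ^+ 2 * (2 * i%:R / expR 1) ^+ (2 * i) * i%:R :> R.
  by rewrite !mulr_ge0 ?exprn_ge0 ?divr_ge0 ?mulr_ge0 // ltW.
have := ler_wpM2l A0 (expR2_le_ratio i0).
rewrite [(i.+1%:R / _) ^+ _]exprSr => h.
have e2 := expR_gt0 (2 : R).
rewrite [leRHS](_ : _ = (2 * i.+1%:R) ^+ 2 * (2 * i%:R / expR 1) ^+ (2 * i) * i%:R *
    ((i.+1%:R / i%:R) ^+ (2 * i) * (i.+1%:R / i%:R))).
  by apply: le_trans h; rewrite le_eqVlt; apply/orP; left; apply/eqP; ring.
by field; rewrite !gt_eqF.
Qed.

Let P r (i : nat) : R := pairings R (2 * r) (2 * i).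

Let PS r i : P r i.+1 = ((2 * i).+2%:R - Num.max 1 ((2 * i).+2%:R / (2 * r)%:R)) * P r i.
Proof. by rewrite /P mulnS pairingsSS. Qed.

(** The entry [1] of the maximum turns the factors into odd numbers, as in a double factorial; the
    factor [2 i + 1] on the left is preserved because [(2 i + 1) (2 i + 3) <= (2 i + 2)^2]. *)
Let P_small r i : (0 < r)%N -> (0 < i)%N ->
  P r i ^+ 2 * (2 * i%:R + 1) <= s i.
Proof.
move=> r0; elim: i => // i IH _.
have fac0 : 0 <= (2 * i).+2%:R - Num.max 1 ((2 * i).+2%:R / (2 * r)%:R) :> R.
  by apply: pairings_factor_ge0; rewrite muln_gt0.
have fac : (2 * i).+2%:R - Num.max 1 ((2 * i).+2%:R / (2 * r)%:R) <= 2 * i%:R + 1 :> R.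
  have : 1 <= Num.max 1 ((2 * i).+2%:R / (2 * r)%:R) :> R by rewrite le_max lexx.
  by rewrite -[(2 * i).+2%:R]natr1 -[(2 * i).+1%:R]natr1 natrM; lra.
have [i00|i0] := posnP i.
  move: fac fac0; rewrite PS i00; set q := _ - _ => fac fac0.
  have -> : P r 0 = 1 by [].
  have -> : s 1 = 4 :> R.
    rewrite /s muln1 mulr1 expr2; have -> : expR 2 = expR 1 ^+ 2 :> R.
      by rewrite -expRM_natr mul1r.
    by field; rewrite gt_eqF // expR_gt0.
  have q1 : q <= 1.
    by move: fac; rewrite mulr0 add0r.
  have q2 : q ^+ 2 <= 1 by nra.
  by rewrite mulr1; lra.
have {}IH := IH i0.
have iR : 1 <= i%:R :> R by rewrite ler1n.
apply: le_trans (s_step i0).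
rewrite PS exprMn.
apply: le_trans (ler_wpM2l (sqr_ge0 (2 * i.+1%:R)) IH).
rewrite -[i.+1%:R]natr1; set q := _ - Num.max _ _ in fac fac0 *.
have P2 := sqr_ge0 (P r i).
have q2 : q ^+ 2 <= (2 * i%:R + 1) ^+ 2 by apply: lerXn2r; rewrite ?nnegrE //; lra.
have q3 : q ^+ 2 * (2 * (i%:R + 1) + 1) <= (2 * (i%:R + 1)) ^+ 2 * (2 * i%:R + 1).
  apply: (@le_trans _ _ ((2 * i%:R + 1) ^+ 2 * (2 * (i%:R + 1) + 1))).
    by apply: ler_wpM2r => //; lra.
  rewrite -subr_ge0 [leRHS](_ : _ = 2 * i%:R + 1); [lra | ring].
rewrite [leLHS](_ : _ = q ^+ 2 * (2 * (i%:R + 1) + 1) * P r i ^+ 2); last by ring.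
rewrite [leRHS](_ : _ = (2 * (i%:R + 1)) ^+ 2 * (2 * i%:R + 1) * P r i ^+ 2);
  last by ring.
exact: ler_wpM2r.
Qed.

(** Starting from [P_small] at [i = r], the entry [K / M] of the maximum makes each further factor
    smaller by [1 - 1 / (2 r)], hence gains [expR (- 1 / r)] on the square. *)
Let P_large r i : (0 < r)%N -> (r <= i)%N ->
  P r i ^+ 2 * (2 * r%:R + 1) <= s i * expR (- ((i%:R - r%:R) / r%:R)).
Proof.
move=> r0; have rR : 1 <= r%:R :> R by rewrite ler1n.
elim: i => [|i IH] ri; first by rewrite leqn0 in ri; rewrite (eqP ri) in r0.
have [ri'|ri'] := eqVneq r i.+1.
  by rewrite -ri' subrr mul0r oppr0 expR0 mulr1; apply: P_small.
have {}ri : (r <= i)%N by rewrite leq_eqVlt (negbTE ri') in ri.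
have {}IH := IH ri.
have i0 : (0 < i)%N by apply: leq_trans ri.
have i1 : 0 < i.+1%:R :> R by rewrite ltr0n.
set y := r%:R^-1 : R.
have y0 : 0 < y by rewrite invr_gt0; lra.
have fac0 : 0 <= (2 * i).+2%:R - Num.max 1 ((2 * i).+2%:R / (2 * r)%:R) :> R.
  by apply: pairings_factor_ge0; rewrite muln_gt0.
have e22 : (2 * i).+2 = (2 * i.+1)%N by rewrite mulnS.
have fac : (2 * i).+2%:R - Num.max 1 ((2 * i).+2%:R / (2 * r)%:R) <=
    2 * i.+1%:R * (1 - y / 2) :> R.
  have : (2 * i).+2%:R / (2 * r)%:R <= Num.max 1 ((2 * i).+2%:R / (2 * r)%:R) :> R.
    by rewrite le_max lexx orbT.
  have -> : (2 * i).+2%:R / (2 * r)%:R = i.+1%:R * y :> R.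
    by rewrite e22 !natrM /y; field; apply/eqP; lra.
  have -> : (2 * i).+2%:R = 2 * i.+1%:R :> R by rewrite e22 natrM.
  lra.
have y1 : y <= 1 by rewrite /y invf_le1; lra.
have ey : (1 - y / 2) ^+ 2 <= expR (- y).
  have -> : - y = - (y / 2) * 2%:R by field.
  rewrite expRM_natr; apply: lerXn2r; rewrite ?nnegrE ?expR_ge0 //; first lra.
  exact: expR_ge1Dx.
have -> : - ((i.+1%:R - r%:R) / r%:R) = - ((i%:R - r%:R) / r%:R) + - y :> R.
  by rewrite -[i.+1%:R]natr1 /y; field; apply/eqP; lra.
rewrite expRD PS exprMn.
set q := _ - Num.max _ _ in fac fac0 *; set E := expR (- (_ / _)) in IH *.
have q2 : q ^+ 2 <= (2 * i.+1%:R) ^+ 2 * expR (- y).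
  apply: (@le_trans _ _ ((2 * i.+1%:R * (1 - y / 2)) ^+ 2)).
    apply: lerXn2r; rewrite ?nnegrE //; apply: mulr_ge0; lra.
  by rewrite exprMn; apply: ler_wpM2l => //; apply: sqr_ge0.
have E0 : 0 <= E by apply: expR_ge0.
have ey0 : 0 <= expR (- y) by apply: expR_ge0.
have a0 : 0 <= P r i ^+ 2 * (2 * r%:R + 1) by apply: mulr_ge0; [exact: sqr_ge0 | lra].
have h1 := ler_wpM2r a0 q2.
have b0 : 0 <= (2 * i.+1%:R) ^+ 2 * expR (- y) by apply: mulr_ge0 => //; apply: sqr_ge0.
have h2 := ler_wpM2l b0 IH.
have c0 : 0 <= E * expR (- y) by apply: mulr_ge0.
have h3 := ler_wpM2r c0 (s_step i0).
apply: (@le_trans _ _ (q ^+ 2 * (P r i ^+ 2 * (2 * r%:R + 1)))); first by rewrite [leRHS]mulrA.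
apply: le_trans h1 (le_trans h2 _).
by apply: le_trans _ h3; rewrite le_eqVlt; apply/orP; left; apply/eqP; ring.
Qed.

(** At [i = r d] the gain of [P_large] on the square is [expR (1 - d)]. About half of it absorbs the
    polynomial factor [d / 2], and [expR 2 <= 16] gives the constant [4]. *)
Lemma pairings_le (r d : nat) : (0 < r)%N ->
  pairings R (2 * r) (2 * r * d) <=
  4 * expR (- (d%:R / 4)) * (2 * (r * d)%:R / expR 1) ^+ (r * d).
Proof.
move=> r0; have rR : 1 <= r%:R :> R by rewrite ler1n.
have e0 := expR_gt0 (1 : R).
have [->|d0] := posnP d.
  by rewrite !muln0 mul0r oppr0 expR0 expr0 /=; lra.
have dR : 1 <= d%:R :> R by rewrite ler1n.
have rd : (r <= r * d)%N by rewrite leq_pmulr.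
have := P_large r0 rd; rewrite -[P r (r * d)]/(pairings R (2 * r) (2 * (r * d))) mulnA.
set p := pairings _ _ _ => h.
have p0 : 0 <= p by apply: pairings_ge0; rewrite muln_gt0.
set X := (2 * (r * d)%:R / expR 1) ^+ (r * d) : R.
have X0 : 0 <= X by apply: exprn_ge0; apply: divr_ge0; [apply: mulr_ge0 | exact: expR_ge0].
rewrite -(@ler_pXn2r _ 2) ?nnegrE //; last by rewrite !mulr_ge0 ?expR_ge0.
have sE : s (r * d) = expR 2 * (r * d)%:R * X ^+ 2.
  by rewrite /s /X -exprM mulnC (mulnC 2).
have eE : - (((r * d)%:R - r%:R) / r%:R) = 1 - d%:R :> R.
  by rewrite natrM; field; apply/eqP; lra.
rewrite sE eE in h.
have h2 : p ^+ 2 <= expR 2 * (d%:R / 2) * X ^+ 2 * expR (1 - d%:R).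
  rewrite -(@ler_pM2r _ (2 * r%:R + 1)); last by lra.
  apply: le_trans h _.
  rewrite [leRHS](_ : _ = expR 2 * (d%:R * (r%:R + 1 / 2)) * X ^+ 2 * expR (1 - d%:R)); last by field.
  do 2! (apply: ler_wpM2r; first by rewrite ?sqr_ge0 ?expR_ge0).
  apply: ler_wpM2l; first exact: expR_ge0.
  by rewrite natrM mulrC; nra.
apply: le_trans h2 _.
rewrite !exprMn.
have -> : expR (- (d%:R / 4)) ^+ 2 = expR (- (d%:R / 2)) :> R.
  by rewrite -expRM_natr; congr expR; field.
rewrite [leLHS]mulrAC; apply: ler_wpM2r; first exact: sqr_ge0.
have hd : d%:R / 2 <= expR (d%:R / 2 - 1) :> R.
  by apply: le_trans (expR_ge1Dx _); lra.
have e16 : expR 2 <= 16 :> R.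
  have -> : expR 2 = expR 1 ^+ 2 :> R by rewrite -expRM_natr mul1r.
  by have := expR1_le4; nra.
apply: (@le_trans _ _ (expR 2 * expR (d%:R / 2 - 1) * expR (1 - d%:R))).
  apply: ler_wpM2r; first exact: expR_ge0.
  by apply: ler_wpM2l => //; exact: expR_ge0.
rewrite -mulrA -expRD (_ : d%:R / 2 - 1 + (1 - d%:R) = - (d%:R / 2)); last by field.
apply: ler_wpM2r; first exact: expR_ge0.
by apply: le_trans e16 _; rewrite -natrX.
Qed.

End PairingsBound.

(** * The level-k inequality *)

Section RandomBlock.
Variables (R : realType) (n : nat).
Implicit Types (J S T : {set 'I_n}) (p : cube n -> R).

Definition level_weight j p : R := \sum_(S : {set 'I_n} | #|S| == j) fourier p S ^+ 2.

(* Coefficients of the part of [p] of degree [d.+1] whose monomials meet [J]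
   in exactly the coordinate [j]. *)
Definition block_coef p d J (j : 'I_n) : {set 'I_n} -> R := fun T =>
  if [&& j \in J, [disjoint T & J] & #|T| == d] then fourier p (j |: T) else 0.

Definition block_weight p d J : R := \sum_j nrm2 (block_coef p d J j).

Lemma block_coef_homog p d J j : homog d (block_coef p d J j).
Proof.
by move=> T; rewrite /block_coef; case: and3P => [[_ _ /eqP]|]; rewrite ?eqxx.
Qed.

Lemma block_weightE p d J : block_weight p d J =
  \sum_(S : {set 'I_n} | #|S| == d.+1) fourier p S ^+ 2 *
    \sum_(j in S) ((j \in J) && [disjoint S :\ j & J])%:R.
Proof.
transitivity (\sum_j \sum_(S : {set 'I_n} | j \in S) (#|S| == d.+1)%:R *
   (fourier p S ^+ 2 * ((j \in J) && [disjoint S :\ j & J])%:R)).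
  apply: eq_bigr => j _; rewrite -sum_setU1 /nrm2 [RHS]big_mkcond.
  apply: eq_bigr => T _; rewrite /block_coef.
  have [jT|jT] := boolP (j \in T).
    case: and3P => [[jJ dT _]|_]; last by rewrite expr0n.
    by rewrite (disjointFr dT jT) in jJ.
  rewrite cardsU1 jT add1n eqSS setU1K //.
  case: (j \in J) => /=; last by rewrite mulr0 mulr0 expr0n.
  case: [disjoint T & J] => /=; last by rewrite !mulr0 expr0n.
  by case: (#|T| == d); rewrite ?mul1r ?mulr1 // mul0r expr0n.
under eq_bigr do rewrite big_mkcond.
rewrite exchange_big [RHS]big_mkcond; apply: eq_bigr => S _ /=.
case: (#|S| == d.+1); last first.
  by rewrite big1 // => j _; case: (j \in S); rewrite ?mul0r.
by rewrite big_distrr [RHS]big_mkcond; apply: eq_bigr => j _ /=; rewrite mul1r.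
Qed.

(** The choices are independent: [j] takes colour [ord0], the other [d] points of [S] avoid it, and
    the points outside [S] are free. *)
Lemma sum_colorings d S (j : 'I_n) : j \in S -> #|S| = d.+1 ->
  \sum_(c : {ffun 'I_n -> 'I_d.+1})
    ((j \in [set i | c i == ord0]) && [disjoint S :\ j & [set i | c i == ord0]])%:R
  = (d ^ d * d.+1 ^ (n - d.+1))%:R :> R.
Proof.
move=> jS cS.
pose F (i : 'I_n) (a : 'I_d.+1) : R :=
  if i == j then (a == ord0)%:R else if i \in S then (a != ord0)%:R else 1.
transitivity (\sum_(c : {ffun 'I_n -> 'I_d.+1}) \prod_i F i (c i)).
  apply: eq_bigr => c _.
  have [/andP[jc dis]|H] := boolP (_ && _).
    rewrite big1 // => i _; rewrite /F; case: eqP => [->|/eqP ij].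
      by rewrite inE in jc; rewrite jc.
    case: ifP => // iS; have := disjointFr dis; move=> /(_ i).
    by rewrite !inE ij iS => /(_ isT) ->.
  apply/esym; move: H; rewrite inE negb_and => /orP[cj|].
    by rewrite (bigD1 j) //= /F eqxx (negbTE cj) mul0r.
  rewrite disjoints_subset => /subsetPn[i]; rewrite !inE negbK => /andP[ij iS] ci.
  by rewrite (bigD1 i) //= /F (negbTE ij) iS ci mul0r.
rewrite -(bigA_distr_bigA F).
rewrite (bigD1 j) //=.
have -> : \sum_a F j a = 1.
  rewrite (bigD1 ord0) //= /F !eqxx big1 ?addr0 // => a a0.
  by rewrite (negbTE a0).
rewrite mul1r (bigID (fun i => i \in S)) /= natrM; congr (_ * _).
  rewrite (eq_bigr (fun=> d%:R)).
    rewrite prodr_const natrX; congr (_ ^+ _).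
    rewrite (_ : #|_| = #|S :\ j|); last by apply: eq_card => i; rewrite !inE.
    by have := cardsD1 j S; rewrite jS cS => -[].
  move=> i /andP[ij iS]; rewrite (eq_bigr (fun a : 'I_d.+1 => (a != ord0)%:R)).
    rewrite (bigD1 ord0) //= add0r (eq_bigr (fun=> 1)) => [|a -> //].
    by rewrite sumr_const cardC1 card_ord.
  by move=> a _; rewrite /F (negbTE ij) iS.
rewrite (eq_bigr (fun=> d.+1%:R)).
  rewrite prodr_const natrX; congr (_ ^+ _).
  rewrite (_ : #|_| = #|~: S|).
    by rewrite cardsCs setCK card_ord cS.
  apply: eq_card => i; rewrite [LHS]unfold_in /= inE.
  by have [->|] := eqVneq i j; rewrite ?jS.
move=> i /andP[ij iS]; rewrite (eq_bigr (fun=> 1)).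
  by rewrite sumr_const card_ord.
by move=> a _; rewrite /F (negbTE ij) (negbTE iS).
Qed.

(* A uniformly random class of a random [d.+1]-colouring meets a set of size
   [d.+1] in one point with probability [(d / d.+1) ^ d]. *)
Lemma exists_block p d : exists J,
  (d ^ d)%:R * level_weight d.+1 p <= (d.+1 ^ d)%:R * block_weight p d J.
Proof.
have [nd|dn] := ltnP n d.+1.
  exists set0; rewrite [level_weight _ _]big_pred0 ?mulr0.
    by rewrite mulr_ge0 // sumr_ge0 // => j _; apply: nrm2_ge0.
  move=> S; apply/negbTE; rewrite neq_ltn.
  by rewrite (leq_ltn_trans (max_card _)) ?card_ord.
apply/existsP; apply: contraT; rewrite negb_exists => /forallP H.
pose J (c : {ffun 'I_n -> 'I_d.+1}) := [set i | c i == ord0].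
have : \sum_(c : {ffun 'I_n -> 'I_d.+1}) (d.+1 ^ d)%:R * block_weight p d (J c) <
    \sum_(c : {ffun 'I_n -> 'I_d.+1}) (d ^ d)%:R * level_weight d.+1 p.
  apply: ltr_sum => [|c _]; last by rewrite ltNge.
  by apply/hasP; exists [ffun=> ord0] => //; rewrite mem_index_enum.
rewrite -big_distrr /= sumr_const card_ffun !card_ord.
have -> : \sum_(c : {ffun 'I_n -> 'I_d.+1}) block_weight p d (J c) =
    level_weight d.+1 p * (d.+1 * (d ^ d * d.+1 ^ (n - d.+1)))%:R.
  under eq_bigr do rewrite block_weightE.
  rewrite exchange_big big_distrl /=; apply: eq_bigr => S /eqP cS.
  rewrite -big_distrr exchange_big /=; congr (_ * _).
  rewrite (eq_bigr _ (fun j jS => sum_colorings jS cS)).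
  by rewrite sumr_const cS -mulrnA mulnC.
rewrite -[X in _ < X]mulr_natr => h; exfalso; move: h; apply/negP; rewrite -leNgt.
rewrite le_eqVlt; apply/orP; left; apply/eqP.
rewrite -[in LHS](subnK dn) expnD !natrM expnS natrM; ring.
Qed.

(** For [T] off [J], the coefficient at [j |: T] is the coefficient at [T], in the outer variables,
    of the degree-1 coefficient at [j] of the restriction to [J]. The weight thus becomes a pairing
    to which the level-1 inequality applies pointwise. *)
Lemma block_weight_corr p d J :
  block_weight p d J = avg (fun x => \sum_j
    (if j \in J then avg (fun y => p (merge J x y) * sg R j y) else 0) *
    ev (block_coef p d J j) x).
Proof.
rewrite avg_sum; apply: eq_bigr => j _.
rewrite /ev (@eq_avg _ _ _ (fun x => \sum_T block_coef p d J j T *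
   ((if j \in J then avg (fun y => p (merge J x y) * sg R j y) else 0) * chi R T x))).
  rewrite avg_sum; apply: eq_bigr => T _; rewrite avgZ expr2.
  rewrite /block_coef; case: and3P => [[jJ dT _]|_]; last by rewrite !mul0r.
  congr (_ * _); rewrite jJ.
  have jT : j \notin T by apply: contraL jJ => jT; rewrite (disjointFr dT jT).
  rewrite fourierE (avg_merge J); apply: eq_avg => x.
  rewrite mulrC -avgZ; apply: eq_avg => y.
  rewrite chi_setU1 // chi_merge_notin // /sg mergeE jJ; ring.
by move=> x; rewrite big_distrr /=; apply: eq_bigr => T _; ring.
Qed.

End RandomBlock.

(** Jensen's inequality for the weight [a], obtained from the tangent to [s^(M + 1)] at the weighted
    mean of [b]. *)
Lemma power_mean (R : realType) (n M : nat) (a b : cube n -> R) :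
  (forall x, 0 <= a x) -> (forall x, 0 <= b x) ->
  avg (fun x => a x * b x) ^+ M.+1 <= avg a ^+ M * avg (fun x => a x * b x ^+ M.+1).
Proof.
move=> a0 b0.
have tangent (s t : R) : 0 <= s -> 0 <= t ->
    t ^+ M.+1 + M.+1%:R * t ^+ M * (s - t) <= s ^+ M.+1.
  move=> s0 t0; elim: M => [|m IH]; first by rewrite !expr1 expr0; lra.
  rewrite [s ^+ _]exprS.
  apply: le_trans (ler_wpM2l s0 IH).
  have tm : 0 <= t ^+ m by apply: exprn_ge0.
  rewrite -subr_ge0 [leRHS](_ : _ = m.+1%:R * t ^+ m * (s - t) ^+ 2).
    by apply: mulr_ge0; [apply: mulr_ge0 | exact: sqr_ge0].
  rewrite !exprS -[m.+2%:R]natr1; ring.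
have [A0|A0] := eqVneq (avg a) 0.
  have az := avg_eq0 a0 A0.
  have -> : avg (fun x => a x * b x) = 0.
    by rewrite -[RHS](@avg_cst R n); apply: eq_avg => x; rewrite az mul0r.
  rewrite expr0n /= mulr_ge0 ?exprn_ge0 ?A0 //.
  by apply: avg_ge0 => x; rewrite mulr_ge0 ?exprn_ge0.
have Apos : 0 < avg a by rewrite lt0r A0 avg_ge0.
set E := avg (fun x => a x * b x).
have E0 : 0 <= E by apply: avg_ge0 => x; rewrite mulr_ge0.
set t := E / avg a.
have t0 : 0 <= t by rewrite divr_ge0 // ltW.
have tE : t * avg a = E by rewrite divfK.
clearbody t.
have h : t ^+ M.+1 * avg a <= avg (fun x => a x * b x ^+ M.+1).
  apply: (@le_trans _ _ (avg (fun x => (t ^+ M.+1 - M.+1%:R * t ^+ M * t) * a x +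
     M.+1%:R * t ^+ M * (a x * b x)))).
    rewrite avgD !avgZ -/E -tE !exprS.
    by rewrite le_eqVlt; apply/orP; left; apply/eqP; ring.
  apply: le_avg => x; have := ler_wpM2l (a0 x) (tangent (b x) t (b0 x) t0).
  set u := t ^+ M.+1; set v := t ^+ M; set w := M.+1%:R; set z := b x ^+ M.+1.
  by move=> H; apply: le_trans H; rewrite le_eqVlt; apply/orP; left; apply/eqP; ring.
apply: le_trans (ler_wpM2l _ h); last by rewrite exprn_ge0 // ltW.
rewrite -tE exprMn [avg a ^+ M.+1]exprS.
by rewrite le_eqVlt; apply/orP; left; apply/eqP; ring.
Qed.

(** * Combining the level-1 inequality with moments on a block *)

Section BlockInequality.
Variable R : realType.

(** With the outer coordinates fixed, Cauchy-Schwarz and [level1_signed] bound the integrand of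
    [block_weight_corr] by [dl * sqrt (ps * w2)]. [power_mean] with exponent [2 r] removes the root,
    and the moment bound on [w2] returns a factor [W^r] that cancels. *)
Lemma block_weight_pow_le (c : R) : exists r0 : nat,
  forall (n d r : nat) (p : cube n -> R) (J : {set 'I_n}),
  (forall x, `|p x| <= 1) -> (r0 <= r)%N -> (0 < r)%N ->
  block_weight p d J ^+ r <= avg (fun x => `|p x|) ^+ (2 * r).-1 *
    (2 * expR 100 * ((2 * r%:R / expR 1) ^+ r * expR (- c))) *
    pairings R (2 * r) (2 * r * d) / d`!%:R ^+ r.
Proof.
have [r0 Hr0] := expRN_psi_le c; exists r0 => n d r p J p1 r0r rpos.
set W := block_weight p d J; set delta := avg _.
pose dl x := avg (fun y => `|p (merge J x y)|).
have dl0 x : 0 <= dl x by apply: avg_ge0 => y; apply: normr_ge0.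
have dl1 x : dl x <= 1 by rewrite -[leRHS](@avg_cst R n); apply: le_avg => y; apply: p1.
have dlE : avg dl = delta by rewrite /delta [RHS](avg_merge J).
pose h x j := if j \in J then avg (fun y => p (merge J x y) * sg R j y) else 0.
pose w2 x := \sum_j ev (block_coef p d J j) x ^+ 2.
have w20 x : 0 <= w2 x by apply: sumr_ge0 => j _; apply: sqr_ge0.
pose ps x := psi (100 - ln (dl x / 2)).
have lnl x : ln (dl x / 2) <= 0 by apply: ln_le0; have := dl1 x; lra.
have ps0 x : 0 <= ps x.
  by apply: le_trans (@psi_ge _ _ _); have := lnl x; lra.
have hw x : \sum_j h x j * ev (block_coef p d J j) x <= dl x * Num.sqrt (ps x * w2 x).
  have hh : \sum_j h x j ^+ 2 <= dl x ^+ 2 * ps x.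
    apply: (@le_trans _ _ (\sum_j avg (fun y => p (merge J x y) * sg R j y) ^+ 2)).
      by apply: ler_sum => j _; rewrite /h; case: ifP => // _; rewrite expr0n sqr_ge0.
    have := @level1_signed _ _ 100 (fun y => p (merge J x y)) (lexx _) (fun y => p1 _).
    rewrite -/(dl x) /bell -/(ps x) mulrA [2 * _]mulrC divfK //.
    by rewrite exprMn sqr_sqrtr.
  apply: le_trans (ler_norm _) _.
  rewrite -(@ler_pXn2r _ 2) ?nnegrE ?normr_ge0 //; last first.
    by apply: mulr_ge0; [exact: dl0 | exact: sqrtr_ge0].
  rewrite real_normK ?num_real // exprMn sqr_sqrtr ?mulr_ge0 // mulrA.
  by apply: le_trans (sumr_cauchy_schwarz _ _) _; apply: ler_wpM2r; first exact: w20.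
have W0 : 0 <= W by apply: sumr_ge0 => j _; apply: nrm2_ge0.
have Wle : W <= avg (fun x => dl x * Num.sqrt (ps x * w2 x)).
  by rewrite /W block_weight_corr; apply: le_avg.
have [M ME] : exists M, (2 * r)%N = M.+1 by exists (2 * r).-1; rewrite prednK // muln_gt0.
set S0 := 2 * expR 100 * ((2 * r%:R / expR 1) ^+ r * expR (- c)).
have S00 : 0 <= S0 by rewrite !mulr_ge0 ?exprn_ge0 ?divr_ge0 ?mulr_ge0 ?expR_ge0.
have wpow : avg (fun x => w2 x ^+ r) <=
    pairings R (2 * r) (2 * r * d) * (W / d`!%:R) ^+ r.
  by apply: avg_sum_sqr_pow_le => j; apply: block_coef_homog.
have key : W ^+ (2 * r) <= delta ^+ M *
    (S0 * (pairings R (2 * r) (2 * r * d) * (W / d`!%:R) ^+ r)).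
  apply: (@le_trans _ _ (avg (fun x => dl x * Num.sqrt (ps x * w2 x)) ^+ (2 * r))).
    apply: lerXn2r; rewrite ?nnegrE //.
    by apply: avg_ge0 => x; apply: mulr_ge0; [exact: dl0 | exact: sqrtr_ge0].
  rewrite [in leLHS]ME; apply: le_trans (power_mean _ dl0 (fun x => sqrtr_ge0 _)) _.
  rewrite dlE; apply: ler_wpM2l; first by rewrite exprn_ge0 // -dlE avg_ge0.
  apply: le_trans (ler_wpM2l S00 wpow); rewrite -avgZ; apply: le_avg => x.
  rewrite -ME exprM sqr_sqrtr ?mulr_ge0 // exprMn mulrA.
  apply: ler_wpM2r; first exact: exprn_ge0.
  have [d00|dn0] := eqVneq (dl x) 0; first by rewrite d00 mul0r.
  have dpos : 0 < dl x by rewrite lt0r dn0 dl0.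
  have l1 : 1 <= 100 - ln (dl x / 2) by have := lnl x; lra.
  have := Hr0 r _ r0r l1; rewrite -/(ps x) => H.
  (* The conditional mean is expressed through the argument of [psi], as [expRN_psi_le] requires;
     the shift costs the constant [2 expR 100]. *)
  have -> : dl x = 2 * expR 100 * expR (- (100 - ln (dl x / 2))).
    have d20 : 0 < dl x / 2 by lra.
    rewrite opprB expRB lnK ?posrE //.
    by field; rewrite gt_eqF // expR_gt0.
  rewrite -mulrA /S0; apply: ler_wpM2l; last exact: H.
  by rewrite mulr_ge0 ?expR_ge0.
have -> : (2 * r).-1 = M by rewrite ME.
rewrite -/S0.
have f0 : 0 < d`!%:R :> R by rewrite ltr0n fact_gt0.
have [Wz|Wn] := eqVneq W 0.
  rewrite Wz expr0n gtn_eqF // !mulr_ge0 ?invr_ge0 ?exprn_ge0 //.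
    by rewrite -dlE avg_ge0.
  by rewrite pairings_ge0 // muln_gt0.
have Wpos : 0 < W ^+ r by rewrite exprn_gt0 // lt0r Wn.
rewrite -(ler_pM2r Wpos); move: key; rewrite mul2n -addnn exprD => key.
apply: le_trans key _; rewrite (expr_div_n W) addnn -mul2n.
by rewrite le_eqVlt; apply/orP; left; apply/eqP; ring.
Qed.

End BlockInequality.

(** * From one block to all levels up to [k] *)

Section LevelInequality.
Variable R : realType.

Definition level_bound (delta : R) k : R :=
  delta ^+ 2 * ((2 * ln (1 / delta)) ^+ k / k`!%:R).

(* [r * k] exceeds [L] by at most [k], which costs only a factor [expR (k / 4)]. *)
Lemma expR_pow_le (L : R) (r k : nat) : (0 < k)%N -> 4 * k%:R <= L ->
  L <= r%:R * k%:R -> r%:R * k%:R <= L + k%:R ->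
  expR L * ((2 * (r%:R * k%:R) / expR 1) ^+ k) ^+ r <=
  ((2 * L) ^+ k) ^+ r * expR (k%:R / 4).
Proof.
move=> k0 Lk Lr rL; have kR : 1 <= k%:R :> R by rewrite ler1n.
have L0 : 0 < L by lra.
have e0 := expR_gt0 (1 : R).
pose u := (r%:R * k%:R - L) / L.
have h : 2 * (r%:R * k%:R) / expR 1 <= 2 * L * expR (u - 1).
  rewrite expRB [leRHS]mulrA ler_pM2r ?invr_gt0 // -[leRHS]mulrA ler_pM2l //.
  apply: le_trans (ler_wpM2l (ltW L0) (expR_ge1Dx u)).
  by rewrite le_eqVlt; apply/orP; left; apply/eqP; rewrite /u; field; apply/eqP; lra.
have a0 : 0 <= 2 * (r%:R * k%:R) / expR 1 :> R by rewrite divr_ge0 ?expR_ge0.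
have b0 : 0 <= 2 * L * expR (u - 1) by rewrite !mulr_ge0 ?expR_ge0 //; lra.
rewrite -!exprM.
have := lerXn2r (k * r) a0 b0 h.
rewrite [(2 * L * _) ^+ _]exprMn -expRM_natr => h2.
apply: le_trans (ler_wpM2l (expR_ge0 L) h2) _.
rewrite mulrCA; apply: ler_wpM2l; first by rewrite exprn_ge0 //; lra.
rewrite -expRD ler_expR natrM [k%:R * r%:R]mulrC.
have -> : L + (u - 1) * (r%:R * k%:R) = (r%:R * k%:R - L) ^+ 2 / L.
  by rewrite /u; field; apply/eqP; lra.
rewrite ler_pdivrMr //.
have : (r%:R * k%:R - L) ^+ 2 <= k%:R ^+ 2 by apply: lerXn2r; rewrite ?nnegrE; lra.
nra.
Qed.

Lemma level_weight_le : exists C1 : nat, forall (n k : nat) (p : cube n -> R),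
  (forall x, `|p x| <= 1) -> (0 < k)%N ->
  let delta := avg (fun x => `|p x|) in
  0 < delta -> C1%:R * k%:R <= ln (1 / delta) ->
  level_weight k p <= (1 - 2 * k%:R / ln (1 / delta)) * level_bound delta k.
Proof.
(* The gain [expR (- 120)] outweighs the loss [expR 100] and leaves [expR (- 8)] after all other
   constants; [8 <= r] ensures [4 / r <= 1 / 2]. *)
have [r0 Hr0] := block_weight_pow_le (120 : R); exists (maxn r0 8) => n [//|d] p p1 _.
move=> delta d0; set L := ln (1 / delta); set k := d.+1 => LC.
have kR : 1 <= k%:R :> R by rewrite ler1n.
have C8 : 8 <= (maxn r0 8)%:R :> R by rewrite ler_nat leq_maxr.
have Lk : 8 * k%:R <= L by apply: le_trans LC; apply: ler_wpM2r.
have L0 : 0 < L by lra.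
have k4 : 4 * k%:R <= L by lra.
have deltaE : delta = expR (- L) by rewrite /L div1r lnV ?posrE // opprK lnK ?posrE.
have Lk0 : 0 <= L / k%:R by apply: divr_ge0; lra.
(* This places [r k] between [L] and [L + k], the range of [expR_pow_le]. *)
pose r := (Num.truncn (L / k%:R)).+1.
have r1 : L / k%:R < r%:R by apply: truncnS_gt.
have r2 : r%:R <= L / k%:R + 1.
  rewrite /r -natr1 lerD2r; by rewrite truncn_le.
have Lr : L <= r%:R * k%:R.
  by apply: ltW; rewrite -ltr_pdivrMr //; lra.
have rL : r%:R * k%:R <= L + k%:R.
  have := ler_wpM2r (ltW (lt_le_trans ltr01 kR)) r2.
  by rewrite mulrDl mul1r divfK //; apply/eqP; lra.
have rC : (maxn r0 8 <= r)%N.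
  by rewrite -(ler_nat R) ltW // (le_lt_trans _ r1) // ler_pdivlMr //; lra.
have rr0 : (r0 <= r)%N by apply: leq_trans rC; rewrite leq_maxl.
have r8 : (8 <= r)%N by apply: leq_trans rC; rewrite leq_maxr.
have rR : 8 <= r%:R :> R by rewrite ler_nat.
have z0 : 0 <= 4 / r%:R :> R by apply: divr_ge0; lra.
have z1 : 4 / r%:R <= 1 / 2 :> R by rewrite ler_pdivrMr; lra.
have z2 : 0 <= 1 - 4 / r%:R :> R by lra.
have z3 : - 8 = - (2 * (4 / r%:R)) * r%:R :> R by field; apply/eqP; lra.
have z4 : 1 - 2 * k%:R / L >= 1 - 4 / r%:R.
  rewrite lerD2l lerN2 ler_pdivlMr; last by lra.
  by rewrite mulrAC ler_pdivrMr //; lra.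
have L2 : 0 <= 2 * L by lra.
have e8 : 8 <= expR (47 / 4) :> R by apply: le_trans (expR_ge1Dx _); lra.
have e47 : - 8 = 47 / 4 + (- 20 + 1 / 4) :> R by field.
have d4 : - (d%:R / 4) = - (k%:R / 4) + 1 / 4 :> R by rewrite /k -natr1; field.
have [J HJ] := exists_block p d.
have HW := Hr0 n d r p J p1 rr0 isT; rewrite -/delta in HW.
clearbody delta.
set W := level_weight k p in HJ *; set WJ := block_weight p d J in HJ HW.
have W0 : 0 <= W by apply: sumr_ge0 => S _; apply: sqr_ge0.
set PB := (2 * L) ^+ k / k`!%:R.
have phiE : level_bound delta k = delta ^+ 2 * PB by [].
have e0 := expR_gt0 (1 : R).
have f0 : 0 < d`!%:R :> R by rewrite ltr0n fact_gt0.
have dd0 : 0 < (d ^ d)%:R :> R by rewrite ltr0n; case: (d) => // m; rewrite expn_gt0.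
have pair := @pairings_le R r d isT.
set B := 2 * expR 100 * ((2 * r%:R / expR 1) ^+ r * expR (- 120)) in HW.
have B0 : 0 <= B by rewrite !mulr_ge0 ?exprn_ge0 ?divr_ge0 ?mulr_ge0 ?expR_ge0.
have dl0 : 0 <= delta by apply: ltW.
have step1 : (d ^ d)%:R ^+ r * W ^+ r <= (k ^ d)%:R ^+ r *
   (delta ^+ (2 * r).-1 * B * (4 * expR (- (d%:R / 4)) *
    (2 * (r * d)%:R / expR 1) ^+ (r * d)) / d`!%:R ^+ r).
  rewrite -exprMn; apply: (@le_trans _ _ (((k ^ d)%:R * WJ) ^+ r)).
    apply: lerXn2r; rewrite ?nnegrE ?mulr_ge0 //.
    by apply: sumr_ge0 => j _; apply: nrm2_ge0.
  rewrite exprMn; apply: ler_wpM2l; first exact: exprn_ge0.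
  apply: le_trans HW _; rewrite ler_pM2r ?invr_gt0 ?exprn_gt0 //.
  by apply: ler_wpM2l; rewrite // mulr_ge0 ?exprn_ge0.
(* The loss [k^d / d^d] of the random block turns the powers of [d] in the pairing bound into powers
   of [k], and the spare factor [k] completes [d!] to [k!]. *)
have step2 : W ^+ r <= delta ^+ (2 * r).-1 *
   (8 * expR (- 20) * expR (- (d%:R / 4))) *
   (((2 * (r%:R * k%:R) / expR 1) ^+ k) ^+ r / k`!%:R ^+ r).
  rewrite -(@ler_pM2l _ ((d ^ d)%:R ^+ r)) ?exprn_gt0 //.
  apply: le_trans step1 _.
  have -> : (2 * (r * d)%:R / expR 1) ^+ (r * d) =
      (d ^ d)%:R ^+ r * ((2 * r%:R / expR 1) ^+ d) ^+ r :> R.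
    rewrite -exprMn natrX -exprMn mulnC exprM; congr ((_ ^+ _) ^+ _).
    by rewrite natrM; ring.
  have -> : (2 * (r%:R * k%:R) / expR 1) ^+ k =
      2 * r%:R / expR 1 * (2 * r%:R / expR 1) ^+ d * (k%:R * (k ^ d)%:R) :> R.
    rewrite natrX -!exprS -exprMn; congr (_ ^+ _); ring.
  have kf : k`!%:R = k%:R * d`!%:R :> R by rewrite -natrM.
  have alg (x1 x2 x3 x4 x5 x6 x7 x8 x9 y : R) : x9 != 0 -> y != 0 ->
      x2 * (x3 * (2 * x4 * (x7 * x5)) * (4 * x6 * (x1 * x8)) / x9) =
      x1 * (x3 * (8 * (x4 * x5) * x6) * (x7 * x8 * (y * x2) / (y * x9))).
    by move=> x90 y0; field; rewrite x90 y0.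
  have -> : expR (- 20) = expR 100 * expR (- 120) :> R by rewrite -expRD; congr expR; ring.
  rewrite kf /B; set a := 2 * r%:R / expR 1.
  rewrite (exprMn r k%:R d`!%:R) (exprMn r (a * a ^+ d)) (exprMn r a)
    (exprMn r k%:R (k ^ d)%:R).
  rewrite le_eqVlt; apply/orP; left; apply/eqP; apply: alg.
    by rewrite gt_eqF // exprn_gt0.
  by rewrite gt_eqF // exprn_gt0 // (lt_le_trans ltr01).
clear HJ HW pair step1 B0 B.
have step3 : W ^+ r <= (delta ^+ 2 * PB) ^+ r * expR (- 8).
  apply: le_trans step2 _.
  (* One factor [delta] is missing after the power mean; its reciprocal [expR L] is absorbed by
     [expR_pow_le]. *)
  have dE : delta ^+ (2 * r).-1 = delta ^+ (2 * r) * expR L.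
    have [M ME] : exists M, (2 * r)%N = M.+1 by exists (2 * r).-1; rewrite prednK // muln_gt0.
    by rewrite ME /= exprS mulrAC deltaE -expRD addNr expR0 mul1r.
  have hp := @expR_pow_le L r k isT k4 Lr rL.
  rewrite dE.
  have kf0 : 0 < k`!%:R ^+ r :> R by rewrite exprn_gt0 // ltr0n fact_gt0.
  have alg1 (a b c e f : R) : a * b * c * (e / f) = a * c / f * (b * e) by ring.
  have alg2 (a u v w f g v' : R) :
      a * (u * (v * w)) / f * (g * v') = a * (g / f) * (u * (v * v') * w) by ring.
  rewrite alg1.
  apply: (@le_trans _ _ (delta ^+ (2 * r) * (8 * expR (- 20) * expR (- (d%:R / 4))) /
     k`!%:R ^+ r * (((2 * L) ^+ k) ^+ r * expR (k%:R / 4)))).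
    apply: ler_wpM2l => //.
    by rewrite divr_ge0 ?(ltW kf0) // !mulr_ge0 ?exprn_ge0 ?expR_ge0.
  have -> : expR (- (d%:R / 4)) = expR (- (k%:R / 4)) * expR (1 / 4) :> R.
    by rewrite -expRD d4.
  rewrite (exprMn r (delta ^+ 2) PB) -(exprM delta) /PB (expr_div_n _ _ r).
  rewrite alg2.
  apply: ler_wpM2l.
    apply: mulr_ge0; first exact: exprn_ge0.
    by apply: divr_ge0; [apply/exprn_ge0/exprn_ge0 | exact: ltW].
  rewrite -[expR (- (k%:R / 4)) * _]expRD addNr expR0 mulr1 -mulrA -expRD.
  by rewrite e47 [leRHS]expRD; apply: ler_wpM2r; first exact: expR_ge0.
clear step2.
have PB0 : 0 <= PB by apply: divr_ge0 => //; exact: exprn_ge0.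
have phi0 : 0 <= delta ^+ 2 * PB by rewrite mulr_ge0 // exprn_ge0.
(* The [r]-th root of [expR (- 8)] is at most [1 - 4 / r], and [r k <= 2 L] makes this at most
   [1 - 2 k / L]. *)
have step4 : W <= delta ^+ 2 * PB * (1 - 4 / r%:R).
  rewrite -(@ler_pXn2r _ r) ?nnegrE //; last exact: mulr_ge0.
  apply: le_trans step3 _; rewrite (exprMn r (delta ^+ 2 * PB)).
  apply: ler_wpM2l; first exact: exprn_ge0.
  rewrite z3 expRM_natr; apply: lerXn2r; rewrite ?nnegrE ?expR_ge0 //.
  exact: subr1_ge_expR.
by apply: le_trans step4 _; rewrite phiE mulrC; apply: ler_wpM2r.
Qed.

Definition low_weight k n (p : cube n -> R) : R :=
  \sum_(S : {set 'I_n} | (#|S| <= k)%N) fourier p S ^+ 2.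

Lemma low_weightS k n (p : cube n -> R) :
  low_weight k.+1 p = low_weight k p + level_weight k.+1 p.
Proof.
rewrite /low_weight /level_weight (bigID (fun S : {set 'I_n} => #|S| <= k)%N) /=.
congr (_ + _); apply: eq_bigl => S.
  by rewrite andbC; case: leqP => //= h; apply: leqW.
by rewrite -ltnNge eqn_leq.
Qed.

Lemma low_weight0 n (p : cube n -> R) : low_weight 0 p = avg p ^+ 2.
Proof.
rewrite /low_weight (big_pred1 set0) ?avg_set0 // => S.
by rewrite leqn0 cards_eq0.
Qed.

(** Passing from [k] to [k - 1] multiplies [level_bound] by [k / (2 L)], so all lower levels
    together use only part of the saving [2 k / L] at level [k]. *)
Lemma low_weight_le : exists C1 : nat, forall (n k : nat) (p : cube n -> R),
  (forall x, `|p x| <= 1) -> (0 < k)%N ->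
  let delta := avg (fun x => `|p x|) in
  0 < delta -> C1%:R * k%:R <= ln (1 / delta) ->
  low_weight k p <= (1 - k%:R / ln (1 / delta)) * level_bound delta k.
Proof.
have [C1 HC1] := level_weight_le; exists (maxn C1 2) => n k p p1 kpos.
move=> delta d0; set L := ln (1 / delta) => LC.
have LB0 j : 0 <= L -> 0 <= level_bound delta j.
  move=> L0; rewrite /level_bound -/L mulr_ge0 ?sqr_ge0 // divr_ge0 // exprn_ge0 //.
  by rewrite mulr_ge0.
have LBS j : 0 < L -> level_bound delta j = j.+1%:R / (2 * L) * level_bound delta j.+1.
  have alg (a x y c z : R) : y != 0 -> c != 0 -> z != 0 ->
      a * (x / y) = c / z * (a * (z * x / (c * y))).
    by move=> y0 c0 z0; field; rewrite y0 c0 z0.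
  move=> L0; rewrite /level_bound -/L factS natrM [(2 * L) ^+ j.+1]exprS; apply: alg.
  - by rewrite pnatr_eq0 -lt0n fact_gt0.
  - by rewrite pnatr_eq0.
  - by rewrite gt_eqF // mulr_gt0.
case: k kpos LC => // k _; elim: k => [|k IH] LC.
  have C2 : 2 <= (maxn C1 2)%:R :> R by rewrite ler_nat leq_maxr.
  have LC1 : C1%:R * 1%:R <= L.
    by apply: le_trans LC; apply: ler_wpM2r => //; rewrite ler_nat leq_maxl.
  have L0 : 0 < L by lra.
  have := HC1 n 1%N p p1 isT d0 LC1; rewrite -/delta -/L.
  rewrite low_weightS low_weight0.
  have a0 : avg p ^+ 2 <= level_bound delta 0.
    rewrite /level_bound fact0 expr0 divr1 mulr1 -real_normK ?num_real //.
    by apply: lerXn2r; rewrite ?nnegrE // ?ler_norm_avg // ltW.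
  move: a0; rewrite (LBS 0%N L0).
  set b := level_bound delta 1.
  have -> : 1 / (2 * L) * b = (1 / L * b) / 2 by field; apply/eqP; lra.
  have -> : (1 - 2 * 1 / L) * b = b - 2 * (1 / L * b) by field; apply/eqP; lra.
  have -> : (1 - 1 / L) * b = b - (1 / L * b) by field; apply/eqP; lra.
  have : 0 <= 1 / L * b by rewrite mulr_ge0 ?divr_ge0 ?LB0 // ltW.
  by lra.
set C := (maxn C1 2)%:R in IH LC.
have C2 : 2 <= C by rewrite ler_nat leq_maxr.
have LC1 : C1%:R * k.+2%:R <= L.
  by apply: le_trans LC; apply: ler_wpM2r => //; rewrite ler_nat leq_maxl.
have kk : k.+1%:R <= k.+2%:R :> R by rewrite ler_nat.
have k0 : 0 < k.+1%:R :> R by rewrite ltr0n.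
have L0 : 0 < L by nra.
have := HC1 n k.+2 p p1 isT d0 LC1; rewrite -/delta -/L.
have {}IH := IH _.
have : low_weight k.+1 p <= level_bound delta k.+1.
  apply: le_trans (IH _) _; first by nra.
  rewrite -[leRHS]mul1r; apply: ler_wpM2r; first exact/LB0/ltW.
  have : 0 <= k.+1%:R / L by rewrite divr_ge0 // ltW.
  by lra.
rewrite [low_weight k.+2 p]low_weightS (LBS k.+1 L0).
set b := level_bound delta k.+2.
have -> : k.+2%:R / (2 * L) * b = (k.+2%:R / L * b) / 2 by field; apply/eqP; lra.
have -> : (1 - 2 * k.+2%:R / L) * b = b - 2 * (k.+2%:R / L * b) by field; apply/eqP; lra.
have -> : (1 - k.+2%:R / L) * b = b - (k.+2%:R / L * b) by field; apply/eqP; lra.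
have : 0 <= k.+2%:R / L * b by rewrite mulr_ge0 ?divr_ge0 ?LB0 // ltW.
by lra.
Qed.

(** Writing [(2 L)^k / k!] as [4^k] times [(L / 2)^k / k!] bounds it by [expR (3 L / 4)]; since
    [delta = expR (- L)], a factor [expR (- L / 4)] remains. *)
Lemma level_bound_small (delta : R) (k : nat) : 0 < delta -> (0 < k)%N ->
  64 * k%:R <= ln (1 / delta) ->
  level_bound delta k <= k%:R / (2 * ln (1 / delta)) * delta.
Proof.
move=> d0 k0; set L := ln (1 / delta) => Lk.
have kR : 1 <= k%:R :> R by rewrite ler1n.
have L0 : 0 < L by lra.
have deltaE : delta = expR (- L) by rewrite /L div1r lnV ?posrE // opprK lnK ?posrE.
rewrite /level_bound -/L expr2 -mulrA mulrC; apply: ler_wpM2r; first exact: ltW.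
have p1 : (2 * L) ^+ k / k`!%:R <= expR (L / 4) * expR (L / 2).
  have -> : (2 * L) ^+ k / k`!%:R = 4 ^+ k * ((L / 2) ^+ k / k`!%:R).
    by rewrite mulrA -exprMn; congr (_ ^+ _ / _); field.
  apply: ler_pM; rewrite ?exprn_ge0 ?divr_ge0 ?exprn_ge0 //; try lra.
    have -> : L / 4 = (L / (4 * k%:R)) * k%:R by field; apply/eqP; lra.
    rewrite expRM_natr; apply: lerXn2r; rewrite ?nnegrE ?expR_ge0 //.
    apply: le_trans (expR_ge1Dx _).
    have : 3 <= L / (4 * k%:R) by rewrite ler_pdivlMr; lra.
    lra.
  by apply: expr_fact_le_expR; lra.
apply: le_trans (ler_wpM2l (ltW d0) p1) _.
rewrite deltaE -!expRD (_ : - L + (L / 4 + L / 2) = - (L / 4)); last by field.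
apply: (@le_trans _ _ (2 * L)^-1); last first.
  by rewrite -[leLHS]mul1r ler_pM2r // invr_gt0; lra.
rewrite expRN lef_pV2 ?posrE ?expR_gt0 //; last by lra.
have L4 : 0 <= L / 4 by lra.
have := expr_fact_le_expR 2 L4; rewrite (_ : 2`!%:R = 2) //.
apply: le_trans; nra.
Qed.

End LevelInequality.

(** * Approximation by boolean functions of degree k *)

Section KindlerSafra.
Variables (R : realType) (n : nat).
Implicit Types (f g p : cube n -> R) (S T D : {set 'I_n}).

Definition boolean_valued f := forall x, f x = 0 \/ f x = 1.

Definition disagreement f g : R := avg (fun x => `|f x - g x|).

Lemma disagreement_ge0 f g : 0 <= disagreement f g.
Proof. by apply: avg_ge0 => x; apply: normr_ge0. Qed.

Lemma boolean_sub f g x : boolean_valued f -> boolean_valued g ->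
  `|f x - g x| <= 1 /\ `|f x - g x| = (f x - g x) ^+ 2.
Proof.
move=> bf bg; case: (bf x) => ->; case: (bg x) => ->;
  by rewrite ?subrr ?subr0 ?sub0r ?normrN ?normr0 ?normr1 ?sqrrN ?expr0n ?expr1n //=; split.
Qed.

Lemma weight_low_high k f :
  avg (fun x => f x ^+ 2) = low_weight k f + weight_gt k f.
Proof.
rewrite parseval (bigID (fun S => #|S| <= k)%N) /=; congr (_ + _).
by apply: eq_bigl => S; rewrite ltnNge.
Qed.

Lemma fourierB f g S :
  fourier (fun x => f x - g x) S = fourier f S - fourier g S.
Proof. by rewrite -avgB; apply: eq_avg => x; rewrite mulrBl. Qed.

Lemma fourierD f g S :
  fourier (fun x => f x + g x) S = fourier f S + fourier g S.
Proof. by rewrite -avgD; apply: eq_avg => x; rewrite mulrDl. Qed.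

Lemma weight_gt_ge0 k f : 0 <= weight_gt k f.
Proof. by apply: sumr_ge0 => S _; apply: sqr_ge0. Qed.

Lemma weight_gt_sub k f g : degree_le k g ->
  weight_gt k (fun x => f x - g x) = weight_gt k f.
Proof.
by move=> gk; apply: eq_bigr => S kS; rewrite fourierB gk // subr0.
Qed.

Lemma degree_leB k f g : degree_le k f -> degree_le k g ->
  degree_le k (fun x => f x - g x).
Proof. by move=> fk gk S kS; rewrite fourierB fk // gk // subrr. Qed.

Lemma degree_leD k f g : degree_le k f -> degree_le k g ->
  degree_le k (fun x => f x + g x).
Proof. by move=> fk gk S kS; rewrite fourierD fk // gk // addr0. Qed.

Lemma degree_le_upd k i b f : degree_le k f -> degree_le k (fun x => f (upd i b x)).
Proof.
move=> fk S kS; have [iS|iS] := boolP (i \in S); first exact: fourier_upd_in.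
rewrite fourier_upd_notin // !fk // ?mulr0 ?addr0 //.
by rewrite cardsU1 iS; apply: ltn_trans kS _; rewrite add1n.
Qed.

(** On the two faces the coefficients are the sum and the difference of those at [S] and [i |: S],
    so the parallelogram law applies. Hence one of the faces does not increase the weight. *)
Lemma weight_gt_upd k i f :
  weight_gt k (fun x => f (upd i false x)) + weight_gt k (fun x => f (upd i true x))
  <= 2 * weight_gt k f.
Proof.
rewrite /weight_gt -big_split /=.
rewrite (bigID (fun S : {set 'I_n} => i \in S)) /= big1 ?add0r; last first.
  by move=> S /andP[_ iS]; rewrite !fourier_upd_in // expr0n addr0.
rewrite (eq_bigr (fun S => 2 * (fourier f S ^+ 2 + fourier f (i |: S) ^+ 2))); last first.
  by move=> S /andP[_ iS]; rewrite !fourier_upd_notin // expr0 expr1; ring.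
rewrite -big_distrr /=; apply: ler_wpM2l => //.
rewrite big_split [leRHS](bigID (fun S : {set 'I_n} => i \in S)) /= addrC.
apply: lerD => //.
pose F S := if (k < #|S :\ i|)%N then fourier f S ^+ 2 else 0.
apply: (@le_trans _ _ (\sum_(S : {set 'I_n} | i \notin S) F (i |: S))).
  rewrite big_mkcondl; apply: ler_sum => S iS.
  by rewrite /F setU1K.
rewrite sum_setU1 [leRHS]big_mkcondl; apply: ler_sum => S iS.
rewrite /F (cardsD1 i S) iS; case: ifP => h.
  by rewrite (ltn_trans h).
by case: ifP => // _; apply: sqr_ge0.
Qed.

(** Each relevant coordinate adds one factor [2] to the denominator, since a coefficient is half a
    signed sum of coefficients on two faces. *)
Lemma fourier_granular D f S : depends_on D f -> (forall x, f x \is a Num.int) ->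
  fourier f S * 2 ^+ #|D| \is a Num.int.
Proof.
have [m] := ubnP #|D|; elim: m D f S => // m IH D f S Dm fD fint.
have [D0|/set0Pn[i iD]] := eqVneq D set0.
  rewrite D0 cards0 expr0 mulr1.
  have fc x : f x = f [ffun=> false] by apply: fD => i; rewrite D0 inE.
  have -> : fourier f S = f [ffun=> false] * (set0 == S)%:R.
    by rewrite -avg_chi -avgZ; apply: eq_avg => x; rewrite fc chi0 mul1r.
  by rewrite rpredM // natr_int.
have cD : #|D| = #|D :\ i|.+1 by rewrite (cardsD1 i) iD.
have Dm' : (#|D :\ i| < m)%N by rewrite cD in Dm.
have IHb b T : fourier (fun x => f (upd i b x)) T * 2 ^+ #|D :\ i| \is a Num.int.
  by apply: IH => // ; exact: depends_on_upd.
rewrite cD exprSr mulrA.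
suff -> : fourier f S * 2 ^+ #|D :\ i| * 2 =
    fourier (fun x => f (upd i false x)) (S :\ i) * 2 ^+ #|D :\ i| +
    (-1) ^+ (i \in S) * (fourier (fun x => f (upd i true x)) (S :\ i) * 2 ^+ #|D :\ i|).
  apply: rpredD; first exact: IHb.
  by apply: rpredM; [rewrite rpredX // rpredN rpred1 | exact: IHb].
have h : fourier f S * 2 = fourier (fun x => f (upd i false x)) (S :\ i) +
    (-1) ^+ (i \in S) * fourier (fun x => f (upd i true x)) (S :\ i).
  rewrite !fourier_upd_notin ?inE ?eqxx // expr0 expr1.
  have [iS|iS] := boolP (i \in S); first by rewrite setD1K //= expr1; ring.
  by rewrite (setDidPl _) ?disjoints1 ?expr0 //=; [ring | rewrite disjoint_sym disjoints1].
by rewrite mulrAC h; ring.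
Qed.

Lemma boolean_int f : boolean_valued f -> forall x, f x \is a Num.int.
Proof. by move=> bf x; case: (bf x) => ->; rewrite ?int_num0 ?int_num1. Qed.

Lemma degree_le_granular k D f : boolean_valued f -> depends_on D f ->
  weight_gt k f < (4 ^+ #|D|)^-1 -> degree_le k f.
Proof.
move=> bf fD Wk S kS; apply/eqP; apply: contraT => fS.
move: Wk; rewrite ltNge => /negP[]; apply: (@le_trans _ _ (fourier f S ^+ 2)); last first.
  rewrite /weight_gt (bigD1 S) //= lerDl; apply: sumr_ge0 => T _; exact: sqr_ge0.
have := fourier_granular S fD (boolean_int bf) => /norm_intr_ge1.
rewrite mulf_neq0 ?expf_neq0 // => /(_ isT) h.
rewrite -[leLHS]mul1r ler_pdivrMr ?exprn_gt0 //.
have -> : 4 ^+ #|D| = (2 ^+ #|D|) ^+ 2 :> R.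
  by rewrite -exprM mulnC exprM; congr (_ ^+ _); ring.
rewrite -exprMn -real_normK ?num_real //.
exact: exprn_ege1.
Qed.

(* Otherwise the top coefficient [fourier f D] would not vanish. *)
Lemma degree_le_point k D f (z : cube n) : depends_on D f -> degree_le k f ->
  (k < #|D|)%N -> (forall x, f x != 0 -> {in D, x =1 z}) -> forall x, f x = 0.
Proof.
move=> fD fk kD fz.
(* On the support of [f] the character of [D] is constant, so the vanishing top coefficient makes
   the mean vanish; there [f] also has constant sign. *)
have fzz : f z = 0.
  have /eqP := fk D kD.
  have chiz x : f x * chi R D x = chi R D z * f x.
    have [->|/fz xz] := eqVneq (f x) 0; first by rewrite mulr0 mul0r.
    rewrite mulrC; congr (_ * _); apply: eq_bigr => i iD; by rewrite xz.
  have -> : fourier f D = chi R D z * avg f by rewrite -avgZ; apply: eq_avg.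
  have chi_n0 : chi R D z != 0.
    by apply/eqP => c0; have := chi_sqr R D z; rewrite c0 mul0r => /eqP; rewrite eq_sym oner_eq0.
  rewrite mulf_eq0 (negbTE chi_n0) /= => /eqP A0; apply/eqP; apply: contraT => nz.
  have sgE x : `|f x| = Num.sg (f z) * f x.
    have [->|/fz xz] := eqVneq (f x) 0; first by rewrite normr0 mulr0.
    by rewrite (fD x z xz) -normrEsg.
  have : avg (fun x => `|f x|) = 0.
    by rewrite (eq_avg sgE) avgZ A0 mulr0.
  move/(avg_eq0 (fun x => normr_ge0 _))/(_ z)/eqP.
  by rewrite normr_eq0 (negbTE nz).
move=> x; apply/eqP; apply: contraT => fx.
by move: (fx); rewrite (fD x z (fz x fx)) fzz eqxx.
Qed.

Lemma degree_leM j k f g : degree_le j f -> degree_le k g ->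
  degree_le (j + k) (fun x => f x * g x).
Proof.
move=> fj gk U jkU; rewrite fourierM; apply: big1 => S _; apply: big1 => T _.
have [jS|Sj] := ltnP j #|S|; first by rewrite fj // !mul0r.
have [kT|Tk] := ltnP k #|T|; first by rewrite gk // mulr0 mul0r.
case: eqP => [UE|_]; last by rewrite mulr0.
have := card_symdiff S T; rewrite UE => h.
by move: jkU; rewrite ltnNge (leq_trans h) // leq_add.
Qed.

Lemma degree_le_weaken j k f : (j <= k)%N -> degree_le j f -> degree_le k f.
Proof. by move=> jk fj S kS; apply: fj; apply: leq_ltn_trans kS. Qed.

(* Faces are added one at a time: [G] becomes [G + g i - G o upd i (b i)]. *)
Lemma glue_faces k D (E : seq 'I_n) (b : 'I_n -> bool) (g : 'I_n -> cube n -> R) :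
  {subset E <= D} ->
  (forall i, i \in D -> degree_le k (g i)) ->
  (forall i, i \in D -> depends_on (D :\ i) (g i)) ->
  (forall i j, i \in D -> j \in D -> i != j ->
     forall x, g i (upd j (b j) x) = g j (upd i (b i) x)) ->
  exists G : cube n -> R, [/\ degree_le k G, depends_on D G &
    forall i, i \in E -> forall x, G (upd i (b i) x) = g i x].
Proof.
move=> ED gk gD gg; elim: E ED => [|i E IH] ED.
  exists (fun=> 0); split => //.
  by move=> S _; rewrite fourierE -[RHS](@avg_cst R n); apply: eq_avg => x; rewrite mul0r.
have [G [Gk GD GE]] := IH (fun j jE => ED j (mem_behead (s := i :: E) jE)).
have iD : i \in D by apply: ED; rewrite inE eqxx.
have gfree j c x : j \in D -> g j (upd j c x) = g j x.
  by move=> jD; apply: (upd_depends_on _ _ (gD j jD)); rewrite !inE eqxx.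
exists (fun x => G x + (g i x - G (upd i (b i) x))); split.
- by apply: degree_leD => //; apply: degree_leB; [exact: gk | exact: degree_le_upd].
- move=> x y xy; congr (_ + (_ - _)); first exact: GD.
    by apply: (gD i iD) => j; rewrite !inE => /andP[_ /xy].
  by apply: GD => j jD; rewrite !updE; case: eqP => // _; apply: xy.
move=> j; rewrite inE => /predU1P[->|jE] x.
  by rewrite upd_upd gfree // addrC subrK.
have [->|ij] := eqVneq j i; first by rewrite upd_upd gfree // addrC subrK.
have jD : j \in D by apply: ED; rewrite inE jE orbT.
rewrite GE // updC 1?eq_sym // GE // gg // 1?eq_sym //.
by rewrite subrr addr0.
Qed.

End KindlerSafra.

Section Structure.
Variable R : realType.

Lemma ln_inv_ge (delta a : R) : 0 < delta -> delta <= expR (- a) -> a <= ln (1 / delta).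
Proof.
move=> d0 da; rewrite div1r lnV ?posrE // lerNr -[leRHS]expRK ler_ln ?posrE //.
exact: expR_gt0.
Qed.

Lemma low_weight_half : exists C1 : nat, (64 <= C1)%N /\
  (forall (n k : nat) (p : cube n -> R),
  (forall x, `|p x| <= 1) -> (0 < k)%N ->
  let delta := avg (fun x => `|p x|) in
  0 < delta -> delta <= expR (- (C1%:R * k%:R)) ->
  low_weight k p <= (1 - k%:R / ln (1 / delta)) * level_bound delta k) /\
  (forall (n k : nat) (p : cube n -> R),
  (forall x, `|p x| <= 1) -> (0 < k)%N ->
  let delta := avg (fun x => `|p x|) in
  delta <= expR (- (C1%:R * k%:R)) -> low_weight k p <= delta / 2).
Proof.
have [C0 HC0] := low_weight_le R; exists (maxn C0 64); split; first exact: leq_maxr.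
have C64 : 64 <= (maxn C0 64)%:R :> R by rewrite ler_nat leq_maxr.
have sharp n k (p : cube n -> R) : (forall x, `|p x| <= 1) -> (0 < k)%N ->
    0 < avg (fun x => `|p x|) ->
    (maxn C0 64)%:R * k%:R <= ln (1 / avg (fun x => `|p x|)) ->
    low_weight k p <= (1 - k%:R / ln (1 / avg (fun x => `|p x|))) *
      level_bound (avg (fun x => `|p x|)) k.
  move=> p1 k0 d0 h; apply: HC0 => //.
  by apply: le_trans h; apply: ler_wpM2r => //; rewrite ler_nat leq_maxl.
split => n k p p1 k0 delta.
  by move=> d0 /(ln_inv_ge d0); apply: sharp.
have [d00|dn0] := eqVneq delta 0.
  have p0 := avg_eq0 (fun x => normr_ge0 (p x)) d00.
  move=> _; rewrite d00 mul0r /low_weight big1 // => S _.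
  rewrite fourierE (_ : avg _ = 0) ?expr0n // -[RHS](@avg_cst R n).
  by apply: eq_avg => x; have /eqP := p0 x; rewrite normr_eq0 => /eqP ->; rewrite mul0r.
have d0 : 0 < delta by rewrite lt0r dn0; apply: avg_ge0 => x; apply: normr_ge0.
move=> /(ln_inv_ge d0) h; have := sharp n k p p1 k0 d0 h; rewrite -/delta.
have kR : 1 <= k%:R :> R by rewrite ler1n.
set L := ln (1 / delta) in h *.
have Lk : 64 * k%:R <= L by apply: le_trans h; apply: ler_wpM2r.
have L0 : 0 < L by lra.
have := level_bound_small d0 k0 Lk; rewrite -/L.
have B0 : 0 <= level_bound delta k.
  rewrite /level_bound -/L mulr_ge0 ?sqr_ge0 // divr_ge0 // exprn_ge0 //.
  by rewrite mulr_ge0 // ltW.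
have kL0 : 0 <= k%:R / L by rewrite divr_ge0 // ltW.
have kL : k%:R / (2 * L) <= 1 / 2 by rewrite ler_pdivrMr; lra.
clearbody L; clearbody delta; move: (level_bound delta k) B0 => B B0 h1 h2.
have h3 : k%:R / (2 * L) * delta <= 1 / 2 * delta by apply: ler_wpM2r => //; exact: ltW.
have h4 : 0 <= k%:R / L * B by apply: mulr_ge0.
lra.
Qed.

Lemma avg_prod_neq n (s : seq 'I_n) (b : 'I_n -> bool) : uniq s ->
  avg (fun x : cube n => \prod_(i <- s) (x i != b i)%:R) = (2 ^+ size s)^-1 :> R.
Proof.
elim: s => [_|i s IH /= /andP[is_ us]].
  rewrite expr0 invr1 -[RHS](@avg_cst R n); apply: eq_avg => x.
  by rewrite big_nil.
have updP c : avg (fun x : cube n => \prod_(j <- i :: s) (upd i c x j != b j)%:R : R) =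
    (c != b i)%:R * (2 ^+ size s)^-1.
  rewrite -(IH us) -avgZ; apply: eq_avg => x; rewrite big_cons updE eqxx; congr (_ * _).
  rewrite big_seq [RHS]big_seq; apply: eq_bigr => j js; rewrite updE.
  by have [ji|//] := eqVneq j i; rewrite -ji js in is_.
rewrite (avg_upd i) !updP exprS invfM.
by case: (b i) => /=; rewrite ?mul0r ?mul1r ?addr0 ?add0r mulrC.
Qed.

(** The difference is valued in [{-1, 0, 1}], so its mean absolute value is its total weight; at
    most half of that is low, and the high part is that of [f]. For [f] of degree [k] this is
    rigidity: [f = g]. *)
Lemma disagreement_le_weight (n k : nat) (T : R) (f g : cube n -> R) :
  (forall p : cube n -> R, (forall x, `|p x| <= 1) -> avg (fun x => `|p x|) <= T ->
     low_weight k p <= avg (fun x => `|p x|) / 2) ->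
  boolean_valued f -> boolean_valued g -> degree_le k g ->
  disagreement f g <= T -> disagreement f g <= 2 * weight_gt k f.
Proof.
move=> HT bf bg gk fgT.
have := HT (fun x => f x - g x) (fun x => proj1 (boolean_sub x bf bg)) fgT.
have := weight_low_high k (fun x => f x - g x); rewrite weight_gt_sub //.
have -> : avg (fun x => (f x - g x) ^+ 2) = disagreement f g.
  by apply: eq_avg => x; have [_ ->] := boolean_sub x bf bg.
rewrite -[avg _]/(disagreement f g); lra.
Qed.

(** The four numerical conditions serve, in order: granularity for few coordinates, consistency of
    the face approximations, closeness of the glued function, and the degree of [G^2 - G]. *)
Lemma kindler_safra (n k N0 : nat) (T eps0 : R) :
  (forall p : cube n -> R, (forall x, `|p x| <= 1) -> avg (fun x => `|p x|) <= T ->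
     low_weight k p <= avg (fun x => `|p x|) / 2) ->
  eps0 < (4 ^+ N0)^-1 -> 8 * eps0 <= T -> 2 * N0%:R * eps0 + (2 ^+ N0)^-1 <= T ->
  (k + k <= N0)%N ->
  forall (D : {set 'I_n}) (f : cube n -> R), boolean_valued f -> depends_on D f ->
  weight_gt k f <= eps0 ->
  exists g : cube n -> R, [/\ boolean_valued g, depends_on D g, degree_le k g &
    disagreement f g <= 2 * weight_gt k f].
Proof.
move=> HT e4 e8 eN kN D; have [m] := ubnP #|D|; elim: m D => // m IH D Dm f bf fD fW.
have [DN|ND] := leqP #|D| N0.
  exists f; split => //.
    apply: (degree_le_granular bf fD); apply: le_lt_trans fW (lt_le_trans e4 _).
    by rewrite lef_pV2 ?posrE ?exprn_gt0 // ler_weXn2l // ler1n.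
  rewrite [leLHS](_ : _ = 0) ?mulr_ge0 ?weight_gt_ge0 //.
  by rewrite -[RHS](@avg_cst R n); apply: eq_avg => x; rewrite subrr normr0.
have bupd h i b : boolean_valued h -> boolean_valued (fun x : cube n => h (upd i b x) : R).
  by move=> bh x; apply: bh.
have restr i : exists bg : bool * (cube n -> R), i \in D ->
    [/\ boolean_valued bg.2, depends_on (D :\ i) bg.2, degree_le k bg.2 &
      disagreement (fun x => f (upd i bg.1 x)) bg.2 <= 2 * eps0].
  have [iD|_] := boolP (i \in D); last by exists (true, f).
  have [b Wb] : exists b, weight_gt k (fun x => f (upd i b x)) <= weight_gt k f.
    have H := weight_gt_upd k i f.
    have [h|h] := lerP (weight_gt k (fun x => f (upd i false x))) (weight_gt k f).
      by exists false.
    by exists true; lra.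
  have [||||g [bg gD gk fg]] := IH (D :\ i) _ (fun x => f (upd i b x)).
  - by move: Dm; rewrite (cardsD1 i) iD.
  - exact: bupd.
  - exact: depends_on_upd.
  - exact: le_trans Wb fW.
  by exists (b, g); split => //=; apply: le_trans fg _; lra.
have [bg Hbg] := boolp.choice restr.
pose b i := (bg i).1; pose g i := (bg i).2.
have compat i j : i \in D -> j \in D -> i != j ->
    forall x, g i (upd j (b j) x) = g j (upd i (b i) x).
  move=> iD jD ij.
  have [bgi _ gki fgi] := Hbg i iD; have [bgj _ gkj fgj] := Hbg j jD.
  pose u x := g i (upd j (b j) x); pose v x := g j (upd i (b i) x).
  have uk : degree_le k u by apply: degree_le_upd.
  have vk : degree_le k v by apply: degree_le_upd.
  (* Each face approximation errs by at most [2 eps0]; restriction to a second face at most doubles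
     this, and two such errors add up to [8 eps0]. *)
  have uvT : disagreement u v <= T.
    have hi := @avg_upd_le R n j (b j) (fun x => `|f (upd i (b i) x) - g i x|)
      (fun x => normr_ge0 _).
    have hj := @avg_upd_le R n i (b i) (fun x => `|f (upd j (b j) x) - g j x|)
      (fun x => normr_ge0 _).
    have : disagreement u v <=
        avg (fun x => `|f (upd i (b i) (upd j (b j) x)) - g i (upd j (b j) x)|) +
        avg (fun x => `|f (upd j (b j) (upd i (b i) x)) - g j (upd i (b i) x)|).
      rewrite -avgD; apply: le_avg => x; rewrite /u /v (updC _ _ _ ij).
      by rewrite distrC -[leRHS]addrC (distrC (f _) (g j _)) ler_distD.
    rewrite -/(b i) -/(g i) in fgi; rewrite -/(b j) -/(g j) in fgj.
    move: fgi fgj; rewrite /disagreement; lra.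
  have := disagreement_le_weight HT (bupd _ j (b j) bgi) (bupd _ i (b i) bgj) vk uvT.
  have -> : weight_gt k (fun x => (bg i).2 (upd j (b j) x)) = 0.
    by apply: big1 => S kS; rewrite uk // expr0n.
  rewrite mulr0 => uv0 x.
  have uvz : avg (fun x => `|u x - v x|) = 0.
    by apply/eqP; rewrite eq_le uv0 disagreement_ge0.
  have /eqP := avg_eq0 (fun x => normr_ge0 _) uvz x.
  by rewrite normr_eq0 subr_eq0 => /eqP.
have [G [Gk GD GE]] : exists G : cube n -> R, [/\ degree_le k G, depends_on D G &
    forall i, i \in enum D -> forall x, G (upd i (b i) x) = g i x].
  apply: (glue_faces (D := D)) compat.
  - by move=> i; rewrite mem_enum.
  - by move=> i /Hbg[].
  - by move=> i /Hbg[].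
have Gi i (x : cube n) : i \in D -> x i = b i -> G x = g i x.
  by move=> iD xi; rewrite -(GE i) ?mem_enum // -xi upd_id.
have Gbool : boolean_valued G.
  pose H x := G x * G x - G x.
  have H0 : forall x, H x = 0.
    (* [G] is boolean on every chosen face, so [H] can be nonzero only at the corner opposite to all
       of them. *)
    apply: (@degree_le_point R n (k + k) D H [ffun i => ~~ b i]).
    - by move=> x y xy; rewrite /H (GD x y xy).
    - apply: degree_leB; first exact: degree_leM.
      by apply: degree_le_weaken Gk; rewrite leq_addr.
    - exact: leq_ltn_trans kN ND.
    move=> x Hx i iD; rewrite ffunE; apply/eqP; apply: contraT => xi.
    have {}xi : x i = b i by move: xi; case: (x i); case: (b i).
    have [bgi _ _ _] := Hbg i iD.
    move: Hx; rewrite /H (Gi i x iD xi).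
    by case: (bgi x); rewrite -/(g i) => ->; rewrite ?mul0r ?mul1r subrr eqxx.
  move=> x; have := H0 x; rewrite /H => /eqP.
  rewrite -[X in _ - X]mul1r -mulrBl mulf_eq0 subr_eq0.
  by case/orP => /eqP ->; [right | left].
exists G; split => //.
apply: (disagreement_le_weight HT) => //.
pose s := take N0 (enum D).
have sD i : i \in s -> i \in D by move=> /mem_take; rewrite mem_enum.
have us : uniq s by rewrite take_uniq // enum_uniq.
have ss : size s = N0 by rewrite size_take -cardE ND.
(* Either [x] lies on one of [N0] chosen faces, where [G] agrees with [g i], or it avoids them all,
   which has probability [2^(-N0)]. *)
have pointwise x : `|f x - G x| <=
    \sum_(i <- s) `|f (upd i (b i) x) - g i x| + \prod_(i <- s) (x i != b i)%:R.
  have sum0 : 0 <= \sum_(i <- s) `|f (upd i (b i) x) - g i x|.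
    by apply: sumr_ge0 => i _; apply: normr_ge0.
  have [/hasP[i is_ /eqP xi]|noi] := boolP (has (fun i => x i == b i) s).
    rewrite (Gi i x (sD i is_) xi) (big_rem i) //= -{1}(upd_id i x) xi.
    rewrite -addrA lerDl addr_ge0 ?prodr_ge0 //.
    by apply: sumr_ge0 => j _; apply: normr_ge0.
  have -> : \prod_(i <- s) (x i != b i)%:R = 1 :> R.
    rewrite big_seq big1 // => i is_.
    by have := hasPn noi i is_ => /negbTE ->.
  by have [+ _] := boolean_sub x bf Gbool; lra.
apply: le_trans (le_avg pointwise) _; rewrite avgD avg_sum avg_prod_neq // ss.
apply: le_trans eN; rewrite lerD2r.
apply: (@le_trans _ _ (\sum_(i <- s) 2 * eps0)).
  rewrite big_seq [leRHS]big_seq; apply: ler_sum => i is_.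
  by have [] := Hbg i (sD i is_).
by rewrite big_const_seq count_predT ss iter_addr_0 -[leLHS]mulr_natr mulrAC.
Qed.

End Structure.

(** * Choice of constants and the sharp error *)

Theorem theorem1p7 (R : realType) :
  exists C : R, 0 < C /\
    forall (n k : nat) (eps : R) (f : cube n -> bool),
      (0 < k)%N ->
      weight_gt k (realify R f) <= eps ->
      eps <= 2 `^ (- (C * k%:R)) ->
      exists g : cube n -> bool,
        degree_le k (realify R g) /\
        Pr_unif R [set x : cube n | f x != g x]%SET
          <= eps + eps ^+ 2 * ((2 * ln (1 / eps)) ^+ k / k`!%:R).
Proof.
have [C1 [C64 [sharp half]]] := low_weight_half R.
(* Since [T >= 2^(-2 C1 k)] and [N0 <= 2^N0], the conditions of [kindler_safra] become comparisons
   of exponents of two, which this [C] satisfies. *)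
pose C := (10 * C1 + 7)%N; exists C%:R; split; first by rewrite ltr0n /C addnS.
move=> n k eps f k0 fW epsC.
have kR : 1 <= k%:R :> R by rewrite ler1n.
pose eps0 : R := (2 ^+ (C * k))^-1.
have {epsC} eps_le : eps <= eps0.
  by apply: le_trans epsC _; rewrite powRN -natrM powR_mulrn.
pose T : R := expR (- (C1%:R * k%:R)).
pose N0 := ((2 * C1).+1 * k)%N.
have T4 : (2 ^+ (2 * C1 * k))^-1 <= T.
  rewrite /T expRN lef_pV2 ?posrE ?exprn_gt0 ?expR_gt0 //.
  rewrite -natrM -[(C1 * k)%:R]mul1r expRM_natr -mulnA [leRHS]exprM.
  apply: lerXn2r; rewrite ?nnegrE ?expR_ge0 //.
  by rewrite (_ : 2 ^+ 2 = 4) ?expR1_le4 // -natrX.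
have pow_le (a b : nat) : (a <= b)%N -> 2 ^+ a <= 2 ^+ b :> R.
  by move=> ab; apply: ler_weXn2l => //; rewrite ler1n.
have c1 : eps0 < (4 ^+ N0)^-1.
  rewrite ltf_pV2 ?posrE ?exprn_gt0 // (_ : 4 = 2 ^+ 2) -?exprM; last by rewrite -natrX.
  rewrite ltr_eXn2l ?ltr1n // /N0 /C; nia.
have c8 : 8 * eps0 <= T.
  apply: le_trans T4; rewrite /eps0 (_ : 8 = 2 ^+ 3); last by rewrite -natrX.
  rewrite ler_pdivrMr ?exprn_gt0 // mulrC ler_pdivlMr ?exprn_gt0 // -exprD.
  by apply: pow_le; rewrite /C; nia.
have cN : 2 * N0%:R * eps0 + (2 ^+ N0)^-1 <= T.
  have h1 : (2 ^+ N0)^-1 <= T / 2.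
    rewrite ler_pdivlMr // -[2 in X in _ * X]expr1.
    apply: le_trans T4; rewrite mulrC ler_pdivrMr ?exprn_gt0 //.
    rewrite mulrC ler_pdivlMr ?exprn_gt0 // -exprD.
    by apply: pow_le; rewrite /N0; nia.
  have h2 : 2 * N0%:R * eps0 <= T / 2.
    have hN : N0%:R <= 2 ^+ N0 :> R by rewrite -natrX ler_nat ltnW // ltn_expl.
    rewrite ler_pdivlMr //; apply: le_trans T4.
    apply: (@le_trans _ _ (2 * 2 ^+ N0 * eps0 * 2)).
      rewrite ler_pM2r // ler_pM2r ?invr_gt0 ?exprn_gt0 //.
      by rewrite ler_pM2l.
    rewrite -[leLHS](_ : 2 ^+ N0.+2 / 2 ^+ (C * k) = _); last first.
      by rewrite !exprS /eps0; ring.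
    rewrite ler_pdivrMr ?exprn_gt0 // mulrC ler_pdivlMr ?exprn_gt0 // -exprD.
    by apply: pow_le; rewrite /C /N0; nia.
  lra.
have cK : (k + k <= N0)%N by rewrite /N0; nia.
pose fr := realify R f.
have bfr : boolean_valued fr.
  by move=> x; rewrite /fr /realify; case: (f x); [right | left].
have dfr : depends_on setT fr.
  by move=> x y xy; congr fr; apply/ffunP => i; apply: xy.
have [g [bg _ gk fg]] := kindler_safra
  (fun p p1 => half n k p p1 k0) c1 c8 cN cK bfr dfr (le_trans fW eps_le).
pose gb x := g x == 1; exists gb.
have gE : realify R gb =1 g.
  move=> x; rewrite /realify /gb.
  by case: (bg x) => ->; rewrite ?eqxx // eq_sym oner_eq0.
split.
  by move=> S kS; rewrite -(gk S kS); apply: eq_avg => x; rewrite gE.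
have -> : Pr_unif R [set x : cube n | f x != gb x]%SET = disagreement fr g.
  rewrite /Pr_unif /disagreement /avg card_ffun card_bool card_ord natrX; congr (_ / _).
  rewrite -sum1_card natr_sum big_mkcond; apply: eq_bigr => x _.
  rewrite inE -gE /fr /realify; case: (f x); case: (gb x) => /=;
  by rewrite ?subrr ?subr0 ?sub0r ?normrN ?normr0 ?normr1.
set delta := disagreement fr g in fg *.
have eps00 : 0 <= eps by apply: le_trans fW; apply: weight_gt_ge0.
have eps01 : eps <= 1.
  by apply: le_trans eps_le _; rewrite invf_le1 ?exprn_gt0 // exprn_ege1 // ler1n.
have lneps : 0 <= ln (1 / eps).
  have [->|en0] := eqVneq eps 0; first by rewrite invr0 mulr0 ln0.
  apply: ln_ge0; rewrite div1r invf_ge1 //; by rewrite lt0r en0.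
have bound0 : 0 <= level_bound eps k.
  by rewrite /level_bound mulr_ge0 ?sqr_ge0 // divr_ge0 // exprn_ge0 // mulr_ge0.
rewrite -/(level_bound eps k).
(* When [delta > eps > 0], the logarithm for [delta] is the smaller one, so it remains to compare
   the prefactors. *)
have [de|ed] := lerP delta eps; first by lra.
have d0 : 0 < delta by apply: le_lt_trans ed.
have dT : delta <= T by move: fg fW; rewrite -/fr; lra.
have p1 x : `|fr x - g x| <= 1 by have [] := boolean_sub x bfr bg.
have := sharp n k (fun x => fr x - g x) p1 k0 d0 dT.
rewrite -[avg _]/delta.
have := weight_low_high k (fun x => fr x - g x); rewrite weight_gt_sub //.
have -> : avg (fun x => (fr x - g x) ^+ 2) = delta.
  by apply: eq_avg => x; have [_ ->] := boolean_sub x bfr bg.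
clearbody delta.
have LC := ln_inv_ge d0 dT.
set L := ln (1 / delta) in LC *.
have Lk : 64 * k%:R <= L.
  by apply: le_trans LC; apply: ler_wpM2r => //; rewrite ler_nat.
have := level_bound_small d0 k0 Lk; rewrite -/L.
move=> small lowhigh low.
have L0 : 0 < L by lra.
have PB0 : 0 <= (2 * L) ^+ k / k`!%:R by rewrite divr_ge0 // exprn_ge0 //; lra.
have PBle : (2 * L) ^+ k / k`!%:R <= (2 * ln (1 / eps)) ^+ k / k`!%:R.
  have [e0|en0] := eqVneq eps 0.
    (* At [eps = 0] the logarithm takes a default value, but all weight is then low and
       [delta <= delta / 2], a contradiction. *)
    exfalso; move: low; rewrite e0 in fW ed *.
    have kL : k%:R / (2 * L) <= 1 / 2 by rewrite ler_pdivrMr; lra.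
    have kL0 : 0 <= k%:R / L by rewrite divr_ge0 // ltW.
    have B0 : 0 <= level_bound delta k by rewrite /level_bound mulr_ge0 ?sqr_ge0.
    have h3 : k%:R / (2 * L) * delta <= 1 / 2 * delta by apply: ler_wpM2r => //; exact: ltW.
    have h4 : 0 <= k%:R / L * level_bound delta k by apply: mulr_ge0.
    rewrite -/fr in fW; lra.
  have epos : 0 < eps by rewrite lt0r en0.
  rewrite ler_pM2r ?invr_gt0 ?ltr0n ?fact_gt0 //.
  apply: lerXn2r; rewrite ?nnegrE; [lra | by rewrite mulr_ge0 | ].
  rewrite ler_pM2l // ler_ln ?posrE ?divr_gt0 //.
  by rewrite !div1r lef_pV2 ?posrE // ltW.
rewrite -/fr in fW.
move: small low; rewrite /level_bound -/L.
have -> : k%:R / (2 * L) = (k%:R / L) / 2 by field; apply/eqP; lra.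
have kL1 : k%:R / L <= 1 by rewrite ler_pdivrMr; lra.
have kL0 : 0 <= k%:R / L by rewrite divr_ge0 // ltW.
move: (k%:R / L) kL0 kL1 => eta eta0 eta1.
move: ((2 * L) ^+ k / _) ((2 * ln (1 / eps)) ^+ k / _) PB0 PBle => PBd PBe PB0 PBle small low.
(* Here the factor [1 - k / L] of the sharp inequality is spent: the crude bound gives
   [(1 - eta / 2) delta <= eps], whose square dominates [(1 - eta) delta^2]. *)
have e2 : (1 - eta) * delta ^+ 2 <= eps ^+ 2.
  have h1 : (1 - eta / 2) * delta <= eps.
    have : 0 <= eta * (delta ^+ 2 * PBd).
      by apply: mulr_ge0 => //; apply: mulr_ge0 => //; apply: sqr_ge0.
    lra.
  have h2 : 0 <= (1 - eta / 2) * delta by apply: mulr_ge0; lra.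
  have h3 : ((1 - eta / 2) * delta) ^+ 2 <= eps ^+ 2 by apply: lerXn2r.
  have h4 : 0 <= eta ^+ 2 * delta ^+ 2 by apply: mulr_ge0; apply: sqr_ge0.
  by apply: le_trans h3; lra.
have h5 : (1 - eta) * delta ^+ 2 * PBd <= eps ^+ 2 * PBe.
  by apply: ler_pM => //; apply: mulr_ge0; [lra | exact: sqr_ge0].
lra.
Qed.
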